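(* Let $n\ge 4$ and let $L=(l_1,\dots,l_n)$ be a polygonal $n$-linkage that satisfies the triangle inequality and such that no configuration of $L$ fits a straight line. Then the cell complex $CWM^*(L)$ embeds as a subcomplex in the face lattice of the cyclopermutohedron $\mathcal{CP}_n$; that is, there is an injective, dimension- and incidence-preserving map from the set of cells of $CWM^*(L)$ to the set of proper faces of $\mathcal{CP}_n$ whose image is closed under passing to faces.
   Context: $[n]=\{1,\dots,n\}$. A polygonal $n$-linkage is a sequence of positive numbers $L=(l_1,\dots,l_n)$; the triangle inequality means each $l_i$ is smaller than the sum of the others. A configuration of $L$ in the Euclidean plane is a sequence of points $(p_1,\dots,p_n)$, $p_i\in\mathbb{R}^2$, with $l_i=|p_i,p_{i+1}|$ for $i<n$ and $l_n=|p_n,p_1|$. The moduli space $M(L)$ is the set of all configurations modulo orientation-preserving isometries of $\mathbb{R}^2$. Cyclically ordered partitions: partitions of $[n]$ into non-empty parts together with a cyclic (oriented) order of the parts, written as strings $(I_1,\dots,I_k)$ modulo cyclic rotation. $\lambda'$ refines $\lambda$ (is finer than $\lambda$) if $\lambda'$ is obtained by replacing each part of $\lambda$ by a linearly ordered partition of that part, keeping the cyclic order. A partition of $[n]$ is admissible (for $L$) if for each part $I$ the total length $\sum_{i\in I}l_i$ does not exceed the total length $\sum_{i\notin I}l_i$ of the rest. $CWM^*(L)$ is the regular cell complex (a cell structure on $M(L)$) whose $k$-cells are labeled by all admissible cyclically ordered partitions of $[n]$ into $n-k$ non-empty parts, a closed cell $C$ lying in the boundary of another closed cell $C'$ if and only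 if the label of $C$ is finer than the label of $C'$. Virtual polytopes: convex polytopes in $\mathbb{R}^{d}$ form a cancellative commutative semigroup under Minkowski addition; virtual polytopes are the elements of its Grothendieck group, i.e. formal differences $P-Q$ with $P_1-Q_1=P_2-Q_2$ iff $P_1+Q_2=P_2+Q_1$. For a convex polytope $K$ and $\xi\in\mathbb{R}^d$, $K^\xi=\{x\in K:\ (x,\xi)\ge (y,\xi)\ \forall y\in K\}$; for a virtual polytope, $(P-Q)^\xi:=P^\xi-Q^\xi$. The virtual polytopes $K^\xi$ are the faces of $K$; $F'$ is a face of $F$ if $F'=F^\eta$ for some $\eta$. The dimension of a virtual polytope is the least dimension of a linear subspace $W$ such that it can be written as $P-Q$ with $P$ and $Q$ each lying in a translate of $W$. Cyclopermutohedron $\mathcal{CP}_n$: put $d=n-1$, let $e_1,\dots,e_d$ be the standard basis of $\mathbb{R}^d$, $S=(1,\dots,1)\in\mathbb{R}^d$, $R_i=\sum_{j=1}^d(e_i-e_j)$, $q_{ij}=[e_i,e_j]$ for $1\le i<j\le d$, $r_i=[0,R_i]$ for $1\le i\le d$. Then $$\mathcal{CP}_{n}=\sum_{i<j}q_{ij}+S-\sum_{i=1}^{d} r_i .$$ Its proper faces are the faces $\mathcal{CP}_n^\xi$ with $\xi\in\mathbb{R}^d$ not a scalar multiple of $(1,\dots,1)$. *)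

(* Defs.v *)
From HB Require Import structures.
From mathcomp Require Import all_boot all_order all_algebra.
From mathcomp Require Import boolp classical_sets reals.
From mathcomp Require Import topology normedtype sequences.
Import Order.TTheory GRing.Theory Num.Theory.
Import numFieldNormedType.Exports.

Set Implicit Arguments.
Unset Strict Implicit.
Unset Printing Implicit Defensive.

Local Open Scope classical_set_scope.
Local Open Scope ring_scope.
Local Open Scope quotient_scope.

(* The index set {1, ..., n} is represented by 'I_n = {0, ..., n-1}; [ordS] is
   the cyclic successor, so the condition for i = n-1 is l_n = |p_n, p_1|. *)
Section Linkages.
Variables (R : realType) (n : nat).

Definition dotp d (x y : 'rV[R]_d) : R := \sum_i x 0 i * y 0 i.

(* The library norm on 'rV[R]_d is the sup norm. *)
Definition edist d (x y : 'rV[R]_d) : R := Num.sqrt (dotp (x - y) (x - y)).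

Definition linkage (l : 'I_n -> R) := forall i, 0 < l i.

Definition triangle_inequality (l : 'I_n -> R) :=
  forall i, l i < \sum_(j | j != i) l j.

Definition configuration (l : 'I_n -> R) (p : 'I_n -> 'rV[R]_2) :=
  forall i, l i = edist (p i) (p (ordS i)).

Definition fits_line (p : 'I_n -> 'rV[R]_2) :=
  exists a v : 'rV[R]_2, v != 0 /\ forall i, exists t : R, p i = a + t *: v.

End Linkages.

Section CyclicPartitions.

(* [partition] forces the parts to be non-empty; [uniq] is needed because
   [[set:: s]] forgets repetitions. *)
Definition ordered_partition (T : finType) (A : {set T}) (s : seq {set T}) :=
  uniq s && finset.partition [set:: s] A.

Record ostring n := OString {
  parts_seq :> seq {set 'I_n};
  _ : ordered_partition [set: 'I_n] parts_seq }.

HB.instance Definition _ n := [isSub for @parts_seq n].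
HB.instance Definition _ n := [Choice of ostring n by <:].

Variable n : nat.

Definition rotated (s t : ostring n) : bool :=
  `[< exists k, parts_seq t = rot k (parts_seq s) >].

Lemma rotated_refl : reflexive rotated.
Proof. by move=> s; apply/asboolP; exists 0%N; rewrite rot0. Qed.

Lemma rotatedW s t : rotated s t -> rotated t s.
Proof.
move=> /asboolP[k tE]; apply/asboolP; exists (size t - k)%N.
by rewrite -/(rotr k t) tE rotK.
Qed.

Lemma rotated_sym : symmetric rotated.
Proof. by move=> s t; apply/idP/idP; exact: rotatedW. Qed.

Lemma rotated_trans : transitive rotated.
Proof.
move=> t s u /asboolP[k tE] /asboolP[m uE]; apply/asboolP.
rewrite uE tE; set r := parts_seq s.
have [sm|ms] := leqP (size (rot k r)) m; first by exists k; rewrite rot_oversize.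
have [sk|ks] := leqP (size r) k; first by exists m; rewrite (rot_oversize sk).
by eexists; apply: rot_add_mod; rewrite ltnW // -(size_rot k).
Qed.

Canonical rotated_equiv :=
  EquivRel rotated rotated_refl rotated_sym rotated_trans.

Definition cyclic_partition := {eq_quot rotated}.

HB.instance Definition _ := EqQuotient.on cyclic_partition.
HB.instance Definition _ := Choice.on cyclic_partition.

Definition cparts (c : cyclic_partition) : {set {set 'I_n}} :=
  [set:: parts_seq (repr c)].

Lemma cparts_pi (s : ostring n) :
  cparts (\pi_cyclic_partition s) = [set:: parts_seq s].
Proof.
apply/setP => I; rewrite !inE.
have /eqmodP/asboolP[k ->] :
  \pi_cyclic_partition (repr (\pi_cyclic_partition s)) = \pi_cyclic_partition s.
  by rewrite reprK.
by rewrite mem_rot.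
Qed.

Definition nparts (c : cyclic_partition) : nat := #|cparts c|.

Definition refines (c' c : cyclic_partition) : Prop :=
  exists (s t : ostring n) (ss : seq (seq {set 'I_n})),
    [/\ c = \pi_cyclic_partition s, c' = \pi_cyclic_partition t,
        all2 (@ordered_partition 'I_n) s ss & parts_seq t = flatten ss].

End CyclicPartitions.

(* The cells of CWM^* are identified with their labels, so that incidence of
   closed cells is refinement of labels; the cell structure on the moduli space
   itself enters only through this face poset. *)
Section CWM.
Variables (R : realType) (n : nat) (l : 'I_n -> R).

Definition admissible (c : cyclic_partition n) : bool :=
  [forall I in cparts c, \sum_(i in I) l i <= \sum_(i in ~: I) l i].

Definition cell := {c : cyclic_partition n | admissible c}.

Definition cell_dim (C : cell) : nat := (n - nparts (val C))%N.

Definition cell_incident (C C' : cell) : Prop := refines (val C) (val C').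

End CWM.

Section Hull.
Variables (R : realType) (d : nat).
Local Notation V := 'rV[R]_d.

Definition hull (I : finType) (p : I -> V) : set V :=
  [set x | exists w : I -> R,
     [/\ forall i, 0 <= w i, \sum_i w i = 1 & x = \sum_i w i *: p i]].

Definition is_polytope (A : set V) : Prop :=
  exists (m : nat) (p : 'I_m.+1 -> V), A = hull p.

Definition minkowski (A B : set V) : set V := [set x + y | x in A & y in B].

Definition face_set (A : set V) (xi : V) : set V :=
  [set x | A x /\ forall y, A y -> dotp y xi <= dotp x xi].

Lemma dotpDl (x y z : V) : dotp (x + y) z = dotp x z + dotp y z.
Proof. by rewrite -big_split; apply: eq_bigr => i _; rewrite mxE mulrDl. Qed.

Lemma dotp_suml (I : finType) (w : I -> R) (p : I -> V) z :
  dotp (\sum_i w i *: p i) z = \sum_i w i * dotp (p i) z.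
Proof.
rewrite /dotp; under [RHS]eq_bigr do rewrite mulr_sumr.
rewrite exchange_big; apply: eq_bigr => j _; rewrite summxE mulr_suml.
by apply: eq_bigr => i _; rewrite mxE mulrA.
Qed.

Lemma mem_hull (I : finType) (p : I -> V) i : hull p (p i).
Proof.
exists (fun j => (j == i)%:R); split => [j||]; first exact: ler0n.
  by rewrite (bigD1 i) //= eqxx big1 ?addr0 // => j /negPf->.
rewrite (bigD1 i) //= eqxx scale1r big1 ?addr0 // => j /negPf->.
by rewrite scale0r.
Qed.

Lemma hull_comb (I J : finType) (p : I -> V) (q : J -> V) :
  (forall j, hull p (q j)) -> hull q `<=` hull p.
Proof.
move=> /choice[u uP] _ [w [w0 w1 ->]].
exists (fun i => \sum_j w j * u j i); split.
- by move=> i; apply: sumr_ge0 => j _; rewrite mulr_ge0 //; case: (uP j).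
- rewrite exchange_big /= -w1; apply: eq_bigr => j _.
  by rewrite -mulr_sumr; have [_ -> _] := uP j; rewrite mulr1.
- under [RHS]eq_bigr do rewrite scaler_suml.
  rewrite exchange_big /=; apply: eq_bigr => j _.
  have [_ _ ->] := uP j; rewrite scaler_sumr.
  by apply: eq_bigr => i _; rewrite scalerA.
Qed.

Lemma hull_polytope (I : finType) (p : I -> V) (i0 : I) : is_polytope (hull p).
Proof.
have c0 : (0 < #|I|)%N by apply/card_gt0P; exists i0.
exists #|I|.-1.
have e : #|I|.-1.+1 = #|I| by rewrite prednK.
exists (fun k => p (enum_val (cast_ord e k))).
apply/seteqP; split; apply: hull_comb => i; last exact: mem_hull.
rewrite -[i]enum_rankK -[enum_rank i](cast_ordKV e).
exact: (@mem_hull _ (fun k => p (enum_val (cast_ord e k)))).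
Qed.

Lemma minkowski_hull (I J : finType) (p : I -> V) (q : J -> V) :
  minkowski (hull p) (hull q) = hull (fun ij : I * J => p ij.1 + q ij.2).
Proof.
apply/seteqP; split.
- move=> _ [_ [w [w0 w1 ->]] [_ [u [u0 u1 ->]] <-]].
  exists (fun ij => w ij.1 * u ij.2); split.
  + by move=> ij; rewrite mulr_ge0.
  + rewrite -(pair_bigA _ (fun i j => w i * u j)) /= -w1.
    by apply: eq_bigr => i _; rewrite -mulr_sumr u1 mulr1.
  + rewrite -(pair_bigA _ (fun i j => (w i * u j) *: (p i + q j))) /=.
    under [RHS]eq_bigr do under eq_bigr do rewrite scalerDr.
    under [RHS]eq_bigr do rewrite big_split /=.
    rewrite big_split /=; congr (_ + _).
      apply: eq_bigr => i _.
      by rewrite -scaler_suml -mulr_sumr u1 mulr1.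
    rewrite exchange_big; apply: eq_bigr => j _ /=.
    by rewrite -scaler_suml -mulr_suml w1 mul1r.
- move=> _ [w [w0 w1 ->]].
  exists (\sum_i (\sum_j w (i, j)) *: p i).
    exists (fun i => \sum_j w (i, j)); split => //.
      by move=> i; apply: sumr_ge0.
    by rewrite -w1 pair_bigA; apply: eq_bigr => -[].
  exists (\sum_j (\sum_i w (i, j)) *: q j).
    exists (fun j => \sum_i w (i, j)); split => //.
      by move=> i; apply: sumr_ge0.
    by rewrite -w1 exchange_big pair_bigA; apply: eq_bigr => -[].
  under eq_bigr do rewrite scaler_suml.
  under [X in _ + X]eq_bigr do rewrite scaler_suml.
  rewrite [X in _ + X]exchange_big !pair_bigA -big_split /=.
  by apply: eq_bigr => -[i j] _; rewrite scalerDr.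
Qed.

Lemma face_hull (I : finType) (p : I -> V) (i0 : I) xi :
  exists q : I -> V, face_set (hull p) xi = hull q.
Proof.
pose m := [arg max_(i > i0) dotp (p i) xi]%O.
have mP i : dotp (p i) xi <= dotp (p m) xi.
  by rewrite /m; case: arg_maxP => // j _; apply.
have leM y : hull p y -> dotp y xi <= dotp (p m) xi.
  move=> [w [w0 w1 ->]]; rewrite dotp_suml -[leRHS]mul1r -w1 mulr_suml.
  by apply: ler_sum => i _; rewrite ler_wpM2l.
pose q i := if dotp (p i) xi == dotp (p m) xi then p i else p m.
have qM i : dotp (q i) xi = dotp (p m) xi by rewrite /q; case: eqP.
exists q; apply/seteqP; split.
- move=> x [[w [w0 w1 xE]] xM]; exists w; split=> //.
  have dx : dotp x xi = dotp (p m) xi.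
    apply/eqP; rewrite eq_le xM ?andbT; last exact: mem_hull.
    by apply: leM; exists w.
  have /eqP : \sum_i w i * (dotp (p m) xi - dotp (p i) xi) = 0.
    under eq_bigr do rewrite mulrBr.
    by rewrite sumrB -mulr_suml w1 mul1r -dotp_suml -xE dx subrr.
  rewrite psumr_eq0 => [/allP z|i _]; last by rewrite mulr_ge0 ?subr_ge0.
  rewrite xE; apply: eq_bigr => i _; rewrite /q.
  have := z i (mem_index_enum _); rewrite mulf_eq0 subr_eq0.
  rewrite [X in _ || X]eq_sym; case: ifP => // _.
  by rewrite orbF => /eqP->; rewrite !scale0r.
- move=> x qx; split.
    apply: hull_comb qx => i; rewrite /q.
    by case: ifP => _; exact: mem_hull.
  move=> y /leM/le_trans; apply; case: qx => w [w0 w1 ->].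
  rewrite dotp_suml; under eq_bigr do rewrite qM.
  by rewrite -mulr_suml w1 mul1r.
Qed.

Lemma hull_closed (I : finType) (p : I -> V) : closed (hull p).
Proof.
apply: compact_closed; first exact: norm_hausdorff.
pose f (w : 'rV[R]_#|I|) := \sum_i w 0 (enum_rank i) *: p i.
pose g (w : 'rV[R]_#|I|) := \sum_i w 0 (enum_rank i).
pose D := [set w : 'rV[R]_#|I| | forall i, `[0, 1]%classic (w 0 i)].
have gc : continuous g.
  apply: continuous_big => [|i _]; first exact: add_continuous.
  exact: coord_continuous.
have fc : continuous f.
  apply: continuous_big => [|i _ w]; first exact: add_continuous.
  have h := @coord_continuous R 1 #|I| 0 (enum_rank i) w.
  exact: (@cvgZr_tmp R 'rV[R]_d _ (nbhs w) _ _ _ (p i) h).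
have Dc : compact D.
  by apply: (@rV_compact R _ (fun=> `[0, 1]%classic)) => i; exact: segment_compact.
have gcl : closed (g @^-1` [set 1]).
  by apply: closed_comp => [w _|]; [exact: gc|exact: closed_eq].
have -> : hull p = f @` (g @^-1` [set 1] `&` D).
  apply/seteqP; split.
  - move=> _ [w [w0 w1 ->]]; exists (\row_k w (enum_val k)).
      split=> [|k]; rewrite /= /g ?mxE.
        by rewrite -w1; apply: eq_bigr => i _; rewrite mxE enum_rankK.
      rewrite in_itv /= w0 /= -w1 (bigD1 (enum_val k)) //= lerDl.
      exact: sumr_ge0.
    by apply: eq_bigr => i _; rewrite mxE enum_rankK.
  - move=> _ [w [w1 w01] <-]; exists (fun i => w 0 (enum_rank i)); split=> // i.
    by have := w01 (enum_rank i); rewrite /= in_itv => /andP[].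
apply: continuous_compact; first exact/continuous_subspaceT.
by rewrite setIC; apply: compact_closedI.
Qed.

(* Minkowski addition is cancellative: iterating a + c_k = b_k + c_{k+1} gives
   N a + c_0 = b_0 + ... + b_{N-1} + c_N, and b_0, b_1, ... lie in [hull q]. *)
Lemma minkowski_subK (I J : finType) (A : set V) (q : I -> V) (r : J -> V) :
  hull r !=set0 ->
  minkowski A (hull r) `<=` minkowski (hull q) (hull r) -> A `<=` hull q.
Proof.
move=> [c0 Cc0] sub a Aa.
have /choice[F FP] (c : {c | hull r c}) :
    exists bc : V * {c | hull r c}, hull q bc.1 /\ a + sval c = bc.1 + sval bc.2.
  have [|b hb [c' hc' e]] := sub (a + sval c).
    by exists a => //; exists (sval c) => //; exact: (svalP c).
  by exists (b, exist _ c' hc').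
pose c k := iter k (fun c => (F c).2) (exist _ c0 Cc0).
pose b k := (F (c k)).1.
have hb k : hull q (b k) by have [] := FP (c k).
have step N : a *+ N + c0 = \sum_(k < N) b k + sval (c N).
  elim: N => [|N IH]; first by rewrite mulr0n big_ord0.
  rewrite mulrS -addrA IH addrCA big_ord_recr /= -addrA; congr (_ + _).
  by have [_] := FP (c N).
pose M : R := \sum_j `|r j|.
have hM x : hull r x -> `|x| <= M.
  move=> [w [w0 w1 ->]]; apply: le_trans (ler_norm_sum _ _ _) _.
  apply: ler_sum => j _; rewrite normrZ ger0_norm // ler_piMl //.
  by rewrite -w1 (bigD1 j) //= lerDl sumr_ge0.
pose u N : V := (N.+1%:R^-1 : R) *: \sum_(k < N.+1) b k.
have hu N : hull q (u N).
  apply: (@hull_comb _ 'I_N.+1 q (fun k => b k)) => [k|]; first exact: hb.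
  exists (fun _ => N.+1%:R^-1); split.
  - by move=> k; rewrite invr_ge0.
  - by rewrite sumr_const card_ord -[LHS]mulr_natr mulVf ?pnatr_eq0.
  - by rewrite /u scaler_sumr.
apply: (@closed_cvg nat V \oo _ u (hull q) (@hull_closed _ q)) => /=.
  by apply: nearW => N; exact: hu.
apply/cvgrPdist_le => e e0.
have cv : (M *+ 2 * harmonic N) @[N --> \oo] --> (M *+ 2 * 0 : R).
  by apply: cvgMl_tmp; exact: cvg_harmonic.
have /cvgrPdist_le/(_ _ e0) := cv.
apply: filterS => N; rewrite mulr0 sub0r normrN => le_e.
have -> : a - u N = (N.+1%:R^-1 : R) *: (sval (c N.+1) - c0).
  apply: (@scalerI _ _ (N.+1%:R : R)); first by rewrite pnatr_eq0.
  rewrite scalerA mulfV ?scale1r ?pnatr_eq0 // scalerBr /u scalerA mulfV ?pnatr_eq0 //.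
  rewrite scale1r scaler_nat.
  apply/eqP; rewrite subr_eq addrAC eq_sym subr_eq step addrC; exact/eqP.
rewrite normrZ; apply: le_trans le_e; apply: le_trans (ler_norm _).
rewrite mulrC ger0_norm ?invr_ge0 // ler_wpM2r ?invr_ge0 //.
apply: le_trans (ler_normB _ _) _; rewrite mulr2n lerD //; apply: hM => //.
exact: (svalP (c N.+1)).
Qed.

Lemma face_minkowski (A B : set V) xi : A !=set0 -> B !=set0 ->
  face_set (minkowski A B) xi = minkowski (face_set A xi) (face_set B xi).
Proof.
move=> [a0 Aa0] [b0 Bb0]; apply/seteqP; split.
- move=> _ [[a Aa [b Bb <-]] maxab]; exists a.
    split=> // y Ay; have := maxab (y + b); rewrite !dotpDl lerD2r; apply.
    by exists y => //; exists b.
  exists b => //; split=> // y By.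
  have := maxab (a + y); rewrite !dotpDl lerD2l; apply.
  by exists a => //; exists y.
- move=> _ [a [Aa maxa] [b [Bb maxb] <-]]; split.
    by exists a => //; exists b.
  by move=> _ [x Ax [y By <-]]; rewrite !dotpDl lerD ?maxa ?maxb.
Qed.

End Hull.

Record polytope (R : realType) d := Polytope {
  pset :> set 'rV[R]_d;
  _ : `[< is_polytope pset >] }.

HB.instance Definition _ R d := [isSub for @pset R d].
HB.instance Definition _ R d := [Choice of polytope R d by <:].

Section PolytopeSemigroup.
Variables (R : realType) (d : nat).
Local Notation V := 'rV[R]_d.
Implicit Types P Q : polytope R d.

Lemma polytopeP P : exists m (p : 'I_m.+1 -> V), pset P = hull p.
Proof. by case: P => A PA /=; exact/asboolP. Qed.

Lemma polytope_nonempty P : pset P !=set0.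
Proof.
have [m [p ->]] := polytopeP P; exists (p ord0); exact: mem_hull.
Qed.

Lemma hull_subproof (I : finType) (p : I -> V) (i0 : I) :
  `[< is_polytope (hull p) >].
Proof. exact/asboolP/hull_polytope. Qed.

Definition point (a : V) : polytope R d :=
  Polytope (hull_subproof (fun _ : unit => a) tt).

Definition segment (a b : V) : polytope R d :=
  Polytope (hull_subproof (fun i : bool => if i then b else a) true).

Lemma padd_subproof P Q : `[< is_polytope (minkowski P Q) >].
Proof.
have [m [p ->]] := polytopeP P; have [k [q ->]] := polytopeP Q.
by apply/asboolP; rewrite minkowski_hull; exact: (hull_polytope _ (ord0, ord0)).
Qed.

Definition padd P Q : polytope R d := Polytope (padd_subproof P Q).

Lemma pface_subproof P xi : `[< is_polytope (face_set P xi) >].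
Proof.
have [m [p ->]] := polytopeP P; have [q ->] := face_hull p ord0 xi.
exact/asboolP/(hull_polytope _ ord0).
Qed.

Definition pface P (xi : V) : polytope R d := Polytope (pface_subproof P xi).

Lemma pointE a : pset (point a) = [set a].
Proof.
apply/seteqP; split=> [_ [w [_ w1 ->]]|_ ->]; last exact: (mem_hull _ tt).
by rewrite -scaler_suml w1 scale1r.
Qed.

Lemma paddC : commutative padd.
Proof.
move=> P Q; apply/val_inj/seteqP.
by split=> _ [x Px [y Qy <-]]; exists y => //; exists x => //; rewrite addrC.
Qed.

Lemma paddA : associative padd.
Proof.
move=> P Q S; apply/val_inj/seteqP; split.
- move=> _ [x Px [_ [y Qy [z Sz <-]] <-]]; exists (x + y).
    by exists x => //; exists y.
  by exists z => //; rewrite addrA.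
- move=> _ [_ [x Px [y Qy <-]] [z Sz <-]]; exists x => //; exists (y + z).
    by exists y => //; exists z.
  by rewrite addrA.
Qed.

Lemma padd0 : left_id (point 0) padd.
Proof.
move=> P; apply/val_inj; rewrite [LHS]/= -[hull _]/(pset (point 0)) pointE.
apply/seteqP; split.
  by move=> _ [_ -> [x Px <-]]; rewrite add0r.
by move=> x Px; exists 0 => //; exists x => //; rewrite add0r.
Qed.

HB.instance Definition _ :=
  GRing.isNmodule.Build (polytope R d) paddA paddC padd0.

Lemma paddIr (P Q S : polytope R d) : P + S = Q + S -> P = Q.
Proof.
move=> e; have {}e : minkowski P S = minkowski Q S by have := congr1 val e.
have [k [s sE]] := polytopeP S.
have S0 : hull s !=set0 by rewrite -sE; exact: polytope_nonempty.
rewrite sE in e.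
apply/val_inj/seteqP; split.
  have [m [q qE]] := polytopeP Q; rewrite /= qE.
  by apply: (minkowski_subK S0); rewrite e -qE.
have [m [p pE]] := polytopeP P; rewrite /= pE.
by apply: (minkowski_subK S0); rewrite -e -pE.
Qed.

Lemma pfaceD P Q xi : pface (P + Q) xi = pface P xi + pface Q xi.
Proof.
by apply/val_inj/face_minkowski; exact: polytope_nonempty.
Qed.

End PolytopeSemigroup.

Section VirtualPolytopes.
Variables (R : realType) (d : nat).
Local Notation V := 'rV[R]_d.
Local Notation poly := (polytope R d).

Definition vequiv (x y : poly * poly) : bool := x.1 + y.2 == y.1 + x.2.

Lemma vequiv_refl : reflexive vequiv.
Proof. by move=> x; exact: eqxx. Qed.

Lemma vequiv_sym : symmetric vequiv.
Proof. by move=> x y; rewrite /vequiv eq_sym. Qed.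

Lemma vequiv_trans : transitive vequiv.
Proof.
move=> y x z /eqP xy /eqP yz; apply/eqP/(@paddIr _ _ _ _ y.2).
by rewrite addrAC xy addrAC yz addrAC.
Qed.

Canonical vequiv_equiv :=
  EquivRel vequiv vequiv_refl vequiv_sym vequiv_trans.

Definition vpolytope := {eq_quot vequiv}.

HB.instance Definition _ := EqQuotient.on vpolytope.
HB.instance Definition _ := Choice.on vpolytope.

Definition vpoly (P : poly) : vpolytope := \pi_vpolytope (P, 0).

Definition vadd (K L : vpolytope) : vpolytope :=
  \pi_vpolytope ((repr K).1 + (repr L).1, (repr K).2 + (repr L).2).

Definition vopp (K : vpolytope) : vpolytope :=
  \pi_vpolytope ((repr K).2, (repr K).1).

Lemma repr_vpi x : (repr (\pi_vpolytope x)).1 + x.2 = x.1 + (repr (\pi_vpolytope x)).2.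
Proof.
have /eqmodP/eqP// : \pi_vpolytope (repr (\pi_vpolytope x)) = \pi_vpolytope x.
by rewrite reprK.
Qed.

Lemma vadd_pi x y :
  vadd (\pi_vpolytope x) (\pi_vpolytope y) = \pi_vpolytope (x.1 + y.1, x.2 + y.2).
Proof.
by apply/eqmodP/eqP => /=; rewrite addrACA !repr_vpi addrACA.
Qed.

Lemma vopp_pi x : vopp (\pi_vpolytope x) = \pi_vpolytope (x.2, x.1).
Proof.
by apply/eqmodP/eqP => /=; rewrite addrC -repr_vpi addrC.
Qed.

Lemma vaddA : associative vadd.
Proof.
elim/quotW=> x; elim/quotW=> y; elim/quotW=> z.
by rewrite (vadd_pi y z) (vadd_pi x y) !vadd_pi /= !addrA.
Qed.

Lemma vaddC : commutative vadd.
Proof.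
elim/quotW=> x; elim/quotW=> y; rewrite !vadd_pi /=.
by rewrite (addrC x.1) (addrC x.2).
Qed.

Lemma vadd0 : left_id (vpoly 0) vadd.
Proof. by elim/quotW=> -[P Q]; rewrite vadd_pi /= !add0r. Qed.

Lemma vaddN : left_inverse (vpoly 0) vopp vadd.
Proof.
elim/quotW=> -[P Q]; rewrite vopp_pi vadd_pi /=.
by apply/eqmodP/eqP => /=; rewrite addr0 add0r addrC.
Qed.

HB.instance Definition _ :=
  GRing.isZmodule.Build vpolytope vaddA vaddC vadd0 vaddN.

Lemma vpolyD P Q : vpoly (P + Q) = vpoly P + vpoly Q.
Proof. by rewrite [RHS]vadd_pi /= addr0. Qed.

Lemma vpolyB P Q : vpoly P - vpoly Q = \pi_vpolytope (P, Q).
Proof.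
by rewrite -[- _]/(vopp _) vopp_pi [LHS]vadd_pi /= addr0 add0r.
Qed.

Lemma vpolyB_eq P1 Q1 P2 Q2 :
  vpoly P1 - vpoly Q1 = vpoly P2 - vpoly Q2 <-> P1 + Q2 = P2 + Q1.
Proof.
by rewrite !vpolyB; split=> [/eqmodP/eqP//|e]; apply/eqmodP/eqP.
Qed.

(* By [vfaceB], this does not depend on the representation of K chosen by
   [repr]. *)
Definition vface (K : vpolytope) (xi : V) : vpolytope :=
  vpoly (pface (repr K).1 xi) - vpoly (pface (repr K).2 xi).

Lemma vfaceB P Q xi :
  vface (vpoly P - vpoly Q) xi = vpoly (pface P xi) - vpoly (pface Q xi).
Proof.
by rewrite vpolyB; apply/vpolyB_eq; rewrite -!pfaceD repr_vpi.
Qed.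

Definition is_face (F' F : vpolytope) : Prop := exists eta : V, F' = vface F eta.

Definition in_translate (A : set V) (W : {vspace V}) : Prop :=
  exists a : V, forall x, A x -> x - a \in W.

Definition vdim_witness (K : vpolytope) (k : nat) : Prop :=
  exists (P Q : poly) (W : {vspace V}),
    [/\ K = vpoly P - vpoly Q, in_translate P W, in_translate Q W & \dim W = k].

Lemma vdim_subproof K : exists k, `[< vdim_witness K k >].
Proof.
exists (\dim (fullv : {vspace V})); apply/asboolP.
exists (repr K).1, (repr K).2, fullv; split=> //.
- by rewrite vpolyB -surjective_pairing reprK.
- by exists 0 => x _; exact: memvf.
- by exists 0 => x _; exact: memvf.
Qed.

Definition vdim (K : vpolytope) : nat := ex_minn (vdim_subproof K).

End VirtualPolytopes.

Section Cyclopermutohedron.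
Variables (R : realType) (n : nat).
Local Notation d := n.-1.
Local Notation V := 'rV[R]_d.

Definition basis_vec (i : 'I_d) : V := delta_mx 0 i.

Definition ones : V := const_mx 1.

Definition radial_vec (i : 'I_d) : V := \sum_(j < d) (basis_vec i - basis_vec j).

Definition cyclopermutohedron : vpolytope R d :=
  \sum_(i < d) \sum_(j < d | (i < j)%N) vpoly (segment (basis_vec i) (basis_vec j))
  + vpoly (point ones) - \sum_(i < d) vpoly (segment 0 (radial_vec i)).

Definition proper_face (F : vpolytope R d) : Prop :=
  exists xi : V, ~ (exists c : R, xi = c *: ones) /\ F = vface cyclopermutohedron xi.

End Cyclopermutohedron.

(* Main.v *)
Require Import Defs.
From mathcomp Require Import all_boot all_order all_algebra.
From mathcomp Require Import boolp classical_sets reals.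
From mathcomp Require Import zify ring lra.

(** Every face of the cyclopermutohedron can be written down explicitly, and
    the formula depends on a cyclically ordered partition only.

    Put d = n - 1.  Taking the face in direction eta keeps a segment on which
    eta is constant and replaces any other segment by an endpoint.  The segment
    [e_i, e_j] is kept when eta_i = eta_j, and r_i = [0, R_i] is kept when
    eta_i equals the mean of eta.  So the label n behaves as if eta had an n-th
    coordinate, its mean, and - r_i plays the role of the segment of the pair
    {i, n}.  This leads to the virtual polytopes [block_vp E t]: the segments of
    all pairs of labels related by E, plus the translation t.  By
    [vface_block_vp], their faces are again of this form: E is cut by the ties
    of eta, and t moves by an explicit vector.

    A string of blocks s gives such a virtual polytope [level_face (rank s)]:
    E is the relation of being in the same block, and t_i is one plus the number
    of labels met in the blocks strictly after that of n and strictly before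
    that of i, going around the circle.  Hence it depends only on the cyclic
    order ([level_face_rot]), which defines the map [cyclic_face].  Its faces
    come from ordering every block by eta ([vface_level_face]), so they are the
    [cyclic_face] of refinements ([face_is_cyclic_face]).  Conversely, when
    there are at least two blocks every refinement occurs: the only constraint
    is that coordinate n is a mean, and it can be met by shifting the values on
    a block that does not contain n ([hat_surj_blocks], [level_face_refine]).
    The cyclopermutohedron is the case of one block, and a partition in at least
    three blocks, rotated so that the block of n has blocks on both sides, is
    one of its proper faces ([level_face_proper]).

    The map is injective because the pair {i, j} lies in a common block exactly
    when the two opposite endpoints of a suitable face, along the direction of
    its segment, are different points ([tie_faces]); here n >= 4 is used.  Once
    the segments are known, Minkowski cancellation gives t, and t gives the
    order of the blocks ([level_face_inj]).  Applied to directions orthogonal to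
    a subspace W that carries the face, the same injectivity shows that W
    contains the directions of all the segments; they span a space of dimension
    n minus the number of blocks ([vdim_level_face]).

    Finally an admissible partition has at least three blocks: if there were only
    two, they would have equal total length, and going right along the edges of
    one and left along those of the other would close up to a straight
    configuration ([admissible_nparts]). *)

Set Implicit Arguments.
Unset Strict Implicit.
Unset Printing Implicit Defensive.
Import Order.TTheory GRing.Theory Num.Theory.

(** * Faces of virtual polytopes *)
Section Faces.
Local Open Scope ring_scope.
Variables (R : realType) (d : nat).
Local Notation V := 'rV[R]_d.
Implicit Types (a b x eta : V) (K L : vpolytope R d).

Lemma dotpC (x y : V) : dotp x y = dotp y x.
Proof. by apply: eq_bigr => i _; rewrite mulrC. Qed.

Lemma dotpZl c (x y : V) : dotp (c *: x) y = c * dotp x y.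
Proof. by rewrite /dotp mulr_sumr; apply: eq_bigr => i _; rewrite mxE mulrA. Qed.

Lemma dotpBl (x y z : V) : dotp (x - y) z = dotp x z - dotp y z.
Proof. by rewrite dotpDl -scaleN1r dotpZl mulN1r. Qed.

Lemma pset_inj (P Q : polytope R d) : pset P = pset Q -> P = Q.
Proof. by move=> e; apply/val_inj. Qed.

Lemma vpoly_diff K : exists P Q : polytope R d, K = vpoly P - vpoly Q.
Proof.
by exists (repr K).1, (repr K).2; rewrite vpolyB -surjective_pairing reprK.
Qed.

Lemma vfaceD K L eta : vface (K + L) eta = vface K eta + vface L eta.
Proof.
have [P [Q ->]] := vpoly_diff K; have [P' [Q' ->]] := vpoly_diff L.
rewrite addrACA -opprD -!vpolyD !vfaceB !pfaceD !vpolyD.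
by rewrite opprD addrACA.
Qed.

Lemma vface0 eta : vface (0 : vpolytope R d) eta = 0.
Proof. by apply: (addrI (vface 0 eta)); rewrite -vfaceD !addr0. Qed.

Lemma vfaceN K eta : vface (- K) eta = - vface K eta.
Proof. by apply: (addrI (vface K eta)); rewrite -vfaceD !subrr vface0. Qed.

Lemma vface_sum (I : Type) (r : seq I) (P : pred I) (F : I -> vpolytope R d) eta :
  vface (\sum_(i <- r | P i) F i) eta = \sum_(i <- r | P i) vface (F i) eta.
Proof.
by apply: (big_morph (fun K => vface K eta)) => [K L|]; rewrite ?vfaceD ?vface0.
Qed.

Lemma vface_poly P eta : vface (vpoly P) eta = vpoly (pface P eta) :> vpolytope R d.
Proof.
have -> : vpoly P = vpoly P - vpoly 0 by rewrite subr0.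
rewrite vfaceB -[RHS]subr0; congr (_ - _).
apply: (addrI (vpoly (pface (0 : polytope R d) eta))).
by rewrite -vpolyD -pfaceD !addr0.
Qed.

Definition vpt a : vpolytope R d := vpoly (Defs.point a).
Definition vseg a b : vpolytope R d := vpoly (segment a b).

Lemma vptD a b : vpt (a + b) = vpt a + vpt b.
Proof.
rewrite /vpt -vpolyD; congr vpoly; apply: pset_inj.
rewrite -[pset (_ + _)]/(minkowski (pset (Defs.point a)) (pset (Defs.point b))).
rewrite !pointE; apply/seteqP; split.
  by move=> _ ->; exists a => //; exists b.
by move=> _ [_ -> [_ -> <-]].
Qed.

Lemma vptN a : vpt (- a) = - vpt a.
Proof. by apply: (addrI (vpt a)); rewrite -vptD !subrr. Qed.

Lemma vpt_sum (I : Type) (r : seq I) (P : pred I) (F : I -> V) :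
  vpt (\sum_(i <- r | P i) F i) = \sum_(i <- r | P i) vpt (F i).
Proof. by apply: (big_morph vpt) => // a b; rewrite vptD. Qed.

Lemma vpoly_inj : injective (@vpoly R d).
Proof.
move=> P Q e; have /vpolyB_eq : vpoly P - vpoly 0 = vpoly Q - vpoly 0 by rewrite e.
by rewrite !addr0.
Qed.

Lemma vpt_inj : injective vpt.
Proof.
move=> a b /vpoly_inj/(congr1 (@pset R d)); rewrite !pointE => e.
by have : [set a]%classic a by []; rewrite e.
Qed.

Lemma mem_segment a b x :
  pset (segment a b) x <-> exists2 l : R, 0 <= l <= 1 & x = a + l *: (b - a).
Proof.
split.
  move=> [w [w0 w1 ->]]; exists (w true).
    by rewrite w0 -w1 big_bool /= lerDl w0.
  rewrite big_bool /=; have -> : w false = 1 - w true.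
    by rewrite -w1 big_bool /= addrC addrK.
  by rewrite scalerBl scale1r scalerBr addrCA.
move=> [l /andP[l0 l1] ->]; exists (fun i : bool => if i then l else 1 - l).
rewrite !big_bool /=; split; last 2 first.
- by rewrite addrC subrK.
- by rewrite scalerBl scale1r scalerBr addrCA.
by case; rewrite ?subr_ge0.
Qed.

Lemma segmentC a b : segment a b = segment b a.
Proof.
suff sub (u v : V) : (pset (segment u v) `<=` pset (segment v u))%classic.
  by apply/pset_inj/seteqP; split; exact: sub.
move=> x /mem_segment[l /andP[l0 l1] ->]; apply/mem_segment; exists (1 - l).
  by rewrite subr_ge0 l1 gerBl.
rewrite scalerBl scale1r addrA [v + (u - v)]addrC subrK.
by rewrite -[u - v]opprB scalerN opprK.
Qed.

Lemma pface_segment_lt a b eta : dotp a eta < dotp b eta ->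
  pface (segment a b) eta = Defs.point b.
Proof.
move=> ab; apply: pset_inj; rewrite pointE.
rewrite -[pset (pface _ _)]/(face_set (pset (segment a b)) eta).
have dE l : dotp (a + l *: (b - a)) eta =
    dotp b eta - (1 - l) * (dotp b eta - dotp a eta).
  by rewrite dotpDl dotpZl dotpBl; ring.
have sb : pset (segment a b) b.
  by apply/mem_segment; exists 1; rewrite ?ler01 ?lexx // scale1r addrC subrK.
apply/seteqP; split=> [x [/mem_segment[l /andP[l0 l1] ->] /(_ _ sb)]|x ->] /=.
  rewrite dE lerBrDl gerDr pmulr_lle0 ?subr_gt0 // subr_le0 => l1'.
  by have -> : l = 1 by [apply/eqP; rewrite eq_le l1]; rewrite scale1r addrC subrK.
split=> // y /mem_segment[l /andP[l0 l1] ->].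
by rewrite dE gerBl mulr_ge0 ?subr_ge0 // ltW.
Qed.

Lemma pface_const (P : polytope R d) eta c :
  (forall x, pset P x -> dotp x eta = c) -> pface P eta = P.
Proof.
move=> Pc; apply/pset_inj/seteqP; split=> [x []//|x Px]; split=> // y Py.
by rewrite !Pc.
Qed.

Lemma vface_vpt a eta : vface (vpt a) eta = vpt a.
Proof.
rewrite /vpt vface_poly (@pface_const _ _ (dotp a eta)) // => x.
by rewrite pointE => ->.
Qed.

(** The two summands are kept apart so that in a sum of segments the surviving
    segments and the endpoints can be collected separately. *)
Lemma vface_vseg a b eta : vface (vseg a b) eta =
  (if dotp a eta == dotp b eta then vseg a b else 0)
  + vpt ((if dotp b eta < dotp a eta then a else 0)
         + (if dotp a eta < dotp b eta then b else 0)).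
Proof.
rewrite /vseg vface_poly; case: ltgtP => [ba|ab|e]; rewrite ?add0r ?addr0.
- by rewrite segmentC pface_segment_lt.
- by rewrite pface_segment_lt.
rewrite (@pface_const _ _ (dotp a eta)) //.
move=> x /mem_segment[l _ ->].
by rewrite dotpDl dotpZl dotpBl e subrr mulr0 addr0.
Qed.

End Faces.

(** * Sums of the segments of related pairs of labels *)
Section BlockPolytopes.
Local Open Scope ring_scope.
Variables (R : realType) (d : nat).
Local Notation V := 'rV[R]_d.
Local Notation N := 'I_d.+1.
Local Notation last := (@ord_max d).
Local Notation bvec i := (@basis_vec R d.+1 i : V).

Definition emb (i : 'I_d) : N := lift ord_max i.

Lemma embP (P : N -> Prop) : (forall i, P (emb i)) -> P last -> forall i, P i.
Proof. by move=> Pe Pl i; case: (unliftP last i) => [j|] ->. Qed.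

Lemma emb_inj : injective emb.
Proof. exact: lift_inj. Qed.

Lemma emb_eq i j : (emb i == emb j) = (i == j).
Proof. exact: (inj_eq emb_inj). Qed.

Lemma emb_last i : (emb i == last) = false.
Proof. by apply/negbTE; rewrite eq_sym neq_lift. Qed.

Lemma sum_emb (M : nmodType) (F : N -> M) :
  \sum_i F i = \sum_(i < d) F (emb i) + F last.
Proof.
rewrite big_ord_recr /=; congr (_ + _); apply: eq_bigr => i _.
by congr F; apply/val_inj; rewrite /= /bump leqNgt ltn_ord.
Qed.

(** Scaling by d treats all n labels alike: r_i is the segment from 0 to
    [ehat i - ehat n], and e_i - e_j is a multiple of [ehat i - ehat j]. *)
Definition ehat (i : N) : V :=
  if unlift last i is Some j then d%:R *: bvec j else const_mx 1.

(** The direction eta as a function on all labels, n included: up to the common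
    factor d, the coordinates of eta followed by their mean. *)
Definition hat (eta : V) (i : N) : R := dotp (ehat i) eta.

Lemma ehat_emb i : ehat (emb i) = d%:R *: bvec i.
Proof. by rewrite /ehat liftK. Qed.

Lemma ehat_last : ehat last = const_mx 1.
Proof. by rewrite /ehat unlift_none. Qed.

Lemma bvecE i j : bvec i 0 j = (i == j)%:R.
Proof. by rewrite mxE eqxx eq_sym. Qed.

Lemma dotp_bvec i (eta : V) : dotp (bvec i) eta = eta 0 i.
Proof.
rewrite /dotp (bigD1 i) //= bvecE eqxx mul1r big1 ?addr0 // => j /negPf ji.
by rewrite bvecE eq_sym ji mul0r.
Qed.

Lemma hat_emb eta i : hat eta (emb i) = d%:R * eta 0 i.
Proof. by rewrite /hat ehat_emb dotpZl dotp_bvec. Qed.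

Lemma hat_last eta : hat eta last = \sum_i eta 0 i.
Proof.
by rewrite /hat ehat_last; apply: eq_bigr => i _; rewrite mxE mul1r.
Qed.

Lemma hatD eta v i : hat (eta + v) i = hat eta i + hat v i.
Proof. by rewrite /hat dotpC dotpDl !(dotpC _ (ehat i)). Qed.

Lemma hatZ c eta i : hat (c *: eta) i = c * hat eta i.
Proof. by rewrite /hat dotpC dotpZl (dotpC _ (ehat i)). Qed.

Lemma hatN eta i : hat (- eta) i = - hat eta i.
Proof. by rewrite -scaleN1r hatZ mulN1r. Qed.

Lemma hat_bvec i k : hat (bvec i) (emb k) = d%:R * (k == i)%:R.
Proof. by rewrite hat_emb bvecE eq_sym. Qed.

Lemma hat_bvec_last i : hat (bvec i) last = 1.
Proof. by rewrite /hat dotpC dotp_bvec ehat_last mxE. Qed.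

Definition radial i : V := ehat (emb i) - ehat last.

Lemma radial_vecE i : @radial_vec R d.+1 i = radial i.
Proof.
rewrite /radial_vec big_split /= sumr_const card_ord.
rewrite /radial ehat_emb ehat_last scaler_nat; congr (_ + _).
rewrite sumrN; congr (- _); apply/rowP => j; rewrite summxE mxE.
rewrite (bigD1 j) //= mxE !eqxx big1 ?addr0 // => k kj.
by rewrite mxE eq_sym (negPf kj) andbF.
Qed.

Lemma radialE i j : radial i 0 j = d%:R * (i == j)%:R - 1.
Proof. by rewrite /radial ehat_emb ehat_last 2!mxE bvecE !mxE. Qed.

Lemma dotp_radial i eta : dotp (radial i) eta = hat eta (emb i) - hat eta last.
Proof. exact: dotpBl. Qed.

Lemma dotp0 (eta : V) : dotp 0 eta = 0.
Proof. by rewrite -(scale0r (0 : V)) dotpZl mul0r. Qed.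

Lemma dotp_bvec_lt i j eta :
  (dotp (bvec i) eta < dotp (bvec j) eta) = (hat eta (emb i) < hat eta (emb j)).
Proof.
rewrite !hat_emb !dotp_bvec ltr_pM2l // ltr0n.
by case: (d) i => [[]|].
Qed.

Lemma dotp_bvec_eq i j eta :
  (dotp (bvec i) eta == dotp (bvec j) eta) = (hat eta (emb i) == hat eta (emb j)).
Proof. by rewrite !eq_le !leNgt !dotp_bvec_lt. Qed.

(** The segment of the pair {i, n} is r_i, taken with a minus sign. *)
Definition block_vp (E : rel N) (t : V) : vpolytope R d :=
  \sum_(i < d) \sum_(j < d | (i < j)%N && E (emb i) (emb j)) vseg (bvec i) (bvec j)
  + vpt t - \sum_(i < d | E (emb i) last) vseg 0 (radial i).

Lemma eq_block_vp E E' t : E =2 E' -> block_vp E t = block_vp E' t.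
Proof.
move=> EE; rewrite /block_vp; congr (_ + _ - _); last by apply: eq_bigl => i.
by apply: eq_bigr => i _; apply: eq_bigl => j; rewrite EE.
Qed.

(** Minkowski cancellation of the segments. *)
Lemma block_vp_inj E : injective (block_vp E).
Proof. by move=> t t' /addIr/addrI/vpt_inj. Qed.

Lemma cyclopermutohedronE :
  cyclopermutohedron R d.+1 = block_vp (fun _ _ => true) (const_mx 1).
Proof.
rewrite /block_vp /cyclopermutohedron; congr (_ + _ - _).
  by apply: eq_bigr => i _; apply: eq_bigl => j; rewrite andbT.
by apply: eq_bigr => i _; rewrite radial_vecE.
Qed.

(** The endpoints chosen, in a direction with values x, by the segments on which
    x is not constant. *)
Definition face_shift (E : rel N) (x : N -> R) : V :=
  \sum_i \sum_(j | E (emb i) (emb j) && (x (emb j) < x (emb i))) bvec i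
  - \sum_(i | E (emb i) last && (x last < x (emb i))) radial i.

Lemma eq_face_shift E E' x x' :
  (forall i j, E i j && (x j < x i) = E' i j && (x' j < x' i)) ->
  face_shift E x = face_shift E' x'.
Proof.
move=> e; rewrite /face_shift; congr (_ - _).
  by apply: eq_bigr => i _; apply: eq_bigl.
by apply: eq_bigl.
Qed.

(** The last sum comes from the constant -1 that every coordinate of a radial
    vector carries. *)
Lemma face_shiftE E x i : face_shift E x 0 i =
  \sum_j (E (emb i) (emb j) && (x (emb j) < x (emb i)))%R%:R
  - d%:R * (E (emb i) last && (x last < x (emb i)))%R%:R
  + \sum_j (E (emb j) last && (x last < x (emb j)))%R%:R.
Proof.
rewrite /face_shift !mxE !summxE -addrA; congr (_ + _).
  rewrite (bigD1 i) //= [X in _ + X]big1 => [|k ki].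
    rewrite addr0 summxE [LHS]big_mkcond; apply: eq_bigr => j _.
    by rewrite bvecE eqxx; case: ifP.
  by rewrite summxE big1 // => j _; rewrite bvecE (negPf ki).
rewrite [X in - X = _]big_mkcond /=.
have -> : d%:R * (E (emb i) last && (x last < x (emb i)))%R%:R =
  \sum_j d%:R * ((E (emb j) last && (x last < x (emb j)))%R && (j == i))%:R :> R.
  rewrite (bigD1 i) //= eqxx andbT big1 ?addr0 // => j /negPf ->.
  by rewrite andbF mulr0.
rewrite -!sumrN -big_split; apply: eq_bigr => j _ /=; rewrite radialE.
by case: ifP => _ /=; ring.
Qed.

(** The face of a sum is the sum of the faces: a segment survives exactly when
    its two labels are tied under eta, and the others contribute endpoints. *)
Lemma vface_block_vp E t eta : symmetric E ->
  vface (block_vp E t) eta =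
  block_vp (fun i j => E i j && (hat eta i == hat eta j)) (t + face_shift E (hat eta)).
Proof.
move=> symE; rewrite /block_vp 2!vfaceD vfaceN vface_vpt vptD.
rewrite !vface_sum; under eq_bigr do rewrite vface_sum.
under eq_bigr => i _.
  under eq_bigr => j _ do rewrite vface_vseg dotp_bvec_eq !dotp_bvec_lt.
  rewrite big_split -big_mkcondr -vpt_sum /=.
  under eq_bigl do rewrite -andbA.
  over.
under [X in _ - X]eq_bigr => i _.
  rewrite vface_vseg dotp0 dotp_radial eq_sym subr_eq0 subr_lt0 subr_gt0 if_same add0r.
  over.
rewrite !big_split /= -big_mkcondr -!vpt_sum /= -big_mkcondr.
rewrite opprD -!addrA; congr (_ + _).
rewrite addrCA; congr (_ + _).
rewrite addrCA [RHS]addrC; congr (_ + _).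
rewrite -vptN -vptD /face_shift; congr (vpt (_ - _)).
under eq_bigr do rewrite big_split.
rewrite big_split /=; under [X in _ + X]eq_bigr do rewrite big_mkcond.
rewrite [X in _ + X]exchange_big -big_split /=.
apply: eq_bigr => i _; rewrite [X in X + _]big_mkcond.
rewrite -big_split [RHS]big_mkcond /=; apply: eq_bigr => j _.
rewrite (symE (emb j)); case: (ltngtP i j) => [||/val_inj->] /=;
  case: (E _ _) => //=; rewrite ?add0r ?addr0 //.
by rewrite ltxx.
Qed.

Lemma face_shift_const (E : rel N) x :
  (forall i j, E i j -> x i = x j) -> face_shift E x = 0.
Proof.
move=> xE; rewrite /face_shift !big1 ?subr0 // => i.
  by case/andP => /xE ->; rewrite ltxx.
by move=> _; rewrite big1 // => j /andP[/xE->]; rewrite ltxx.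
Qed.

(** Among the pairs of labels tied under eta, only {i, j} is told apart by v. *)
Definition separates (eta v : V) (i j : N) := forall a b,
  (hat eta a == hat eta b) && (hat v b < hat v a) = (a == i) && (b == j).

(** For d >= 3 the mean 2 / d of the coordinates of e_i + e_j is neither 0 nor 1,
    so the ties are only {i, j} and pairs on which e_i - e_j vanishes. *)
Lemma separates_inner i j : (3 <= d)%N -> i != j ->
  separates (bvec i + bvec j) (bvec i - bvec j) (emb i) (emb j).
Proof.
move=> d3 ij; have d0 : 3 <= d%:R :> R by rewrite ler_nat.
apply: embP => [k|]; apply: embP => [m|];
  rewrite !hatD !hatN ?hat_bvec ?hat_bvec_last ?emb_eq ?emb_last
    ?[last == _]eq_sym ?emb_last ?andbF /=.
- case: (eqVneq k i) => [->|_]; case: (eqVneq m i) => [->|_];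
  rewrite ?(negPf ij) /= ?mulr1 ?mulr0;
  try (case: (eqVneq k j) => _); try (case: (eqVneq m j) => _);
  rewrite /= ?mulr1 ?mulr0;
  try (by apply/andP; split; [apply/eqP|]; lra);
  by apply/negbTE/negP => /andP[/eqP ? ?]; lra.
- case: (eqVneq k i) => [->|_]; rewrite ?(negPf ij) /= ?mulr1 ?mulr0;
  try (case: (eqVneq k j) => _); rewrite /= ?mulr1 ?mulr0;
  by apply/negbTE/negP => /andP[/eqP ? ?]; lra.
- case: (eqVneq m i) => [->|_]; rewrite ?(negPf ij) /= ?mulr1 ?mulr0;
  try (case: (eqVneq m j) => _); rewrite /= ?mulr1 ?mulr0;
  by apply/negbTE/negP => /andP[/eqP ? ?]; lra.
- by rewrite ltxx andbF.
Qed.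

(** A direction whose i-th coordinate is 0, the mean, while no other coordinate
    is: put 1 elsewhere except for one coordinate 2 - d. *)
Lemma separates_last i : (3 <= d)%N -> exists eta, separates eta (bvec i) (emb i) last.
Proof.
move=> d3; have d0 : 3 <= d%:R :> R by rewrite ler_nat.
have [k0 k0i] : exists k0 : 'I_d, k0 != i.
  have /card_gt1P[a [b [_ _ ab]]] : (1 < #|'I_d|)%N.
    by rewrite card_ord; apply: ltn_trans d3.
  by have [ai|ai] := eqVneq a i; [exists b; rewrite -ai eq_sym|exists a].
exists (\sum_k bvec k - bvec i - (d%:R - 1) *: bvec k0).
have hS k : hat (\sum_k bvec k) k = d%:R.
  have -> : \sum_k bvec k = ehat last.
    rewrite ehat_last; apply/rowP => j; rewrite summxE mxE (bigD1 j) //= bvecE eqxx.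
    by rewrite big1 ?addr0 // => m mj; rewrite bvecE (negPf mj).
  move: k; apply: embP => [k|]; rewrite ?hat_emb ?hat_last ehat_last ?mxE ?mulr1 //.
  by under eq_bigr do rewrite mxE; rewrite sumr_const card_ord.
apply: embP => [k|]; apply: embP => [m|];
  rewrite !hatD !hatN !hatZ !hS ?hat_bvec ?hat_bvec_last ?emb_eq ?emb_last
    ?[last == _]eq_sym ?emb_last ?eqxx ?andbF ?andbT /=.
- case: (eqVneq k i) => [->|_]; case: (eqVneq m i) => [->|_];
  rewrite ?[i == _]eq_sym ?(negPf k0i) /= ?mulr1 ?mulr0 ?ltxx ?andbF //;
  try (case: (eqVneq k k0) => _); try (case: (eqVneq m k0) => _);
  rewrite /= ?mulr1 ?mulr0;
  by apply/negbTE/negP => /andP[/eqP ? ?]; nra.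
- case: (eqVneq k i) => [->|_];
  rewrite ?[i == _]eq_sym ?(negPf k0i) /= ?mulr1 ?mulr0;
  try (by apply/andP; split; [apply/eqP|]; lra);
  by apply/negbTE/negP => /andP[/eqP ? ?]; lra.
- case: (eqVneq m i) => [->|_];
  rewrite ?[i == _]eq_sym ?(negPf k0i) /= ?mulr1 ?mulr0;
  try (case: (eqVneq m k0) => _); rewrite /= ?mulr1 ?mulr0;
  by apply/negbTE/negP => /andP[/eqP ? ?]; nra.
- by rewrite ltxx.
Qed.

Lemma face_shift_pair (E : rel N) x i j :
  (forall a b, E a b && (x b < x a) = (a == emb i) && (b == j)) ->
  face_shift E x = if unlift last j is Some _ then bvec i else - radial i.
Proof.
move=> h; rewrite /face_shift; case: (unliftP last j) => [j'|] jE.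
  rewrite (bigD1 i) //= (eq_bigl (pred1 j')) ?big_pred1_eq => [|k]; last first.
    by rewrite h jE eqxx -/(emb j') emb_eq.
  rewrite !big1 ?addr0 ?subr0 // => k.
    by rewrite h jE -/(emb j') eq_sym [last == _]eq_sym emb_last andbF.
  by move=> ki; rewrite big1 // => m; rewrite h emb_eq (negPf ki).
rewrite big1 => [|k _]; last by rewrite big1 // => m; rewrite h jE emb_last andbF.
rewrite add0r (eq_bigl (pred1 i)) ?big_pred1_eq // => k.
by rewrite h jE eqxx emb_eq andbT.
Qed.

Lemma face_shift_flip (E : rel N) x i j :
  symmetric E -> (3 <= d)%N -> emb i != j ->
  (forall a b, E a b && (x b < x a) = (a == emb i) && (b == j)) ->
  face_shift E x != face_shift E (fun k => - x k).
Proof.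
move=> symE d3 + h.
have h' a b : E a b && (- x b < - x a) = (a == j) && (b == emb i).
  by rewrite ltrN2 symE h andbC.
have d0 : 3 <= d%:R :> R by rewrite ler_nat.
rewrite (face_shift_pair h); case: (unliftP last j) => [j'|] jE.
  rewrite jE in h' *; rewrite (face_shift_pair h') liftK -/(emb j') emb_eq.
  move=> ij; apply/eqP => /rowP/(_ i); rewrite !bvecE eqxx eq_sym (negPf ij).
  by apply/eqP; rewrite oner_eq0.
have -> : face_shift E (fun k => - x k) = 0.
  rewrite /face_shift !big1 ?subr0 // => k; first by rewrite h' jE emb_last.
  by rewrite big1 // => m; rewrite h' jE emb_last.
move=> _; apply/eqP => /rowP/(_ i).
rewrite [in LHS]mxE radialE eqxx mulr1 [in RHS]mxE; lra.
Qed.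

(** Only the segment of {i, j} can react to v inside the face of eta.  If it is
    present, v and - v select its two endpoints; if not, v is constant on the
    whole face. *)
Lemma tie_faces eta v i j (E : rel N) t :
  (3 <= d)%N -> symmetric E -> emb i != j -> separates eta v (emb i) j ->
  E (emb i) j =
  (vface (vface (block_vp E t) eta) v
   != vface (vface (block_vp E t) eta) (- v)).
Proof.
move=> d3 symE ij sep; rewrite vface_block_vp //.
set E1 := fun a b => _; set t1 := _ + _.
have symE1 : symmetric E1 by move=> a b; rewrite /E1 symE eq_sym.
rewrite !vface_block_vp //.
rewrite (@eq_block_vp _ (fun a b => E1 a b && (hat v a == hat v b)));
  last first => [a b|].
  by rewrite !hatN eqr_opp.
rewrite (inj_eq (@block_vp_inj _)) (inj_eq (addrI _)).
have -> : face_shift E1 (hat (- v)) = face_shift E1 (fun k => - hat v k).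
  by apply: eq_face_shift => a b; rewrite !hatN.
case Eij: (E _ _); apply/esym.
  apply: (face_shift_flip symE1 d3 ij) => a b; rewrite /E1 -andbA sep.
  case: (eqVneq a (emb i)) => [->|_]; rewrite ?andbF //=.
  by case: (eqVneq b j) => [->|_]; rewrite ?Eij ?andbF.
have cst a b : E1 a b -> hat v a = hat v b.
  move=> Eab; have Eba : E1 b a by rewrite symE1.
  apply/eqP; rewrite eq_le !leNgt; apply/andP; split; apply/negP => lt.
    move/andP: Eab => [Eab tie]; have := sep a b; rewrite tie lt /=.
    by move=> /esym/andP[/eqP ea /eqP eb]; rewrite ea eb Eij in Eab.
  move/andP: Eba => [Eba tie]; have := sep b a; rewrite tie lt /=.
  by move=> /esym/andP[/eqP ea /eqP eb]; rewrite ea eb Eij in Eba.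
rewrite !face_shift_const ?eqxx // => a b /cst ->//.
Qed.

(** The condition in [tie_faces] mentions the virtual polytope only, hence it
    recovers E outside the diagonal, which carries no segment. *)
Lemma block_vp_inj2 (E E' : rel N) t t' : (3 <= d)%N ->
  symmetric E -> symmetric E' -> block_vp E t = block_vp E' t' ->
  (forall i j, i != j -> E i j = E' i j) /\ t = t'.
Proof.
move=> d3 symE symE' e.
have emb_case i j : emb i != j -> E (emb i) j = E' (emb i) j.
  move=> ij; have [eta [v sep]] : exists eta v, separates eta v (emb i) j.
    move: j ij; apply: embP => [j|] ij.
      by eexists; eexists; apply: separates_inner => //; rewrite -emb_eq.
    by have [eta sep] := separates_last i d3; exists eta, (bvec i).
  by rewrite (tie_faces t d3 symE ij sep) (tie_faces t' d3 symE' ij sep) e.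
have EE' i j : i != j -> E i j = E' i j.
  move: i j; apply: embP => [i j|]; first exact: emb_case.
  apply: embP => [j|] ij; last by rewrite eqxx in ij.
  by rewrite symE symE' emb_case // eq_sym.
split=> //; apply: (@block_vp_inj E).
rewrite e /block_vp; congr (_ + _ - _).
  apply: eq_bigr => i _; apply: eq_bigl => j; case: ltngtP => //= ij.
  by rewrite EE' // emb_eq; apply: contraTneq ij => ->; rewrite ltnn.
by apply: eq_bigl => i; rewrite EE' // emb_last.
Qed.

End BlockPolytopes.

(** * The face attached to an ordered partition *)
Section OrderedFaces.
Local Open Scope ring_scope.
Variables (R : realType) (d : nat).
Local Notation V := 'rV[R]_d.
Local Notation N := 'I_d.+1.
Local Notation last := (@ord_max d).
Implicit Types p : N -> nat.

Definition same_level p : rel N := fun i j => p i == p j.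

Lemma same_level_sym p : symmetric (same_level p).
Proof. by move=> i j; rewrite /same_level eq_sym. Qed.

(** This is one plus the number of labels met strictly between the block of n and
    the block of i on the circle.  When i comes after n in the string, the first
    sum and the last term together discount the labels up to the block of n.  A
    label in the block of n is reached only after a full turn. *)
Definition translation p : V := \row_i
  (1 + \sum_k (p last < p k)%N%:R + \sum_k (p k < p (emb i))%N%:R
   - d.+1%:R * (p last < p (emb i))%N%:R).

(** The blocks are the level sets of p, ordered by the value of p; only the order
    of the values matters. *)
Definition level_face p : vpolytope R d := block_vp (same_level p) (translation p).

Lemma same_level_lt p i j : same_level p i j = ~~ (p i < p j)%N && ~~ (p j < p i)%N.
Proof. by rewrite -!leqNgt andbC -eqn_leq. Qed.

Lemma cyclopermutohedron_level_face :
  cyclopermutohedron R d.+1 = level_face (fun _ => 0%N).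
Proof.
rewrite cyclopermutohedronE /level_face; congr block_vp.
by apply/rowP => i; rewrite !mxE !big1 // mulr0 !addr0 subr0.
Qed.

(** Refining each block by eta: the labels of the block of n that lie above n
    under eta come after it in the new string, which is what the radial endpoints
    contribute to the translation. *)
Lemma vface_level_face p p' (eta : V) :
  (forall i j, (p' i < p' j)%N =
               (p i < p j)%N || (same_level p i j && (hat eta i < hat eta j))) ->
  vface (level_face p) eta = level_face p'.
Proof.
move=> lex; rewrite /level_face vface_block_vp; last exact: same_level_sym.
have lexE : (fun i j => same_level p i j && (hat eta i == hat eta j)) =2 same_level p'.
  move=> i j; rewrite [in RHS]same_level_lt !lex /same_level eq_sym.
  case: (ltngtP (p i) (p j)) => //= _; rewrite -!leNgt.
  by rewrite eq_le andbC.
rewrite (eq_block_vp _ lexE); congr block_vp; apply/rowP => i.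
have lexR a b : ((p' a < p' b)%N%:R : R) =
    (p a < p b)%N%:R + (same_level p a b && (hat eta a < hat eta b))%:R.
  rewrite lex /same_level; case: (ltngtP (p a) (p b)) => _ /=; rewrite ?addr0 ?add0r //.
rewrite mxE face_shiftE !mxE.
under [\sum_k (p' last < _)%N%:R]eq_bigr do rewrite lexR.
under [\sum_k (p' _ < p' (emb i))%N%:R]eq_bigr do rewrite lexR.
rewrite lexR !big_split /= [\sum_k (same_level p last k && _)%:R]sum_emb.
rewrite [\sum_k (same_level p k (emb i) && _)%:R]sum_emb ltxx andbF /=.
under [\sum_j (same_level p (emb j) last && _)%:R]eq_bigr do rewrite same_level_sym.
under [\sum_j (same_level p (emb i) (emb j) && _)%:R]eq_bigr do rewrite same_level_sym.
rewrite (same_level_sym p (emb i)) -natr1.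
ring.
Qed.

(** Moving the first block to the end: the number of labels before i, minus the
    number of labels up to the block of n, is unchanged modulo n, and
    [translation] is its residue. *)
Lemma level_face_rot p p' :
  (forall i j, (p' i < p' j)%N = (p i != 0)%N && ((p j == 0)%N || (p i < p j)%N)) ->
  level_face p' = level_face p.
Proof.
move=> rotp; rewrite /level_face.
have E : same_level p' =2 same_level p.
  move=> i j; rewrite same_level_lt !rotp same_level_lt.
  by case: (p i) (p j) => [|a] [|b].
rewrite (eq_block_vp _ E); congr block_vp; apply/rowP => i; rewrite !mxE.
have lt0 a b : p a = 0%N -> ((p' a < p' b)%N%:R : R) = 0.
  by move=> a0; rewrite rotp a0.
have gt0 a b : p b = 0%N -> ((p' a < p' b)%N%:R : R) = 1 - (p a == 0)%N%:R.
  by move=> b0; rewrite rotp b0 eqxx /= andbT; case: (_ == _); rewrite ?subrr ?subr0.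
have ltr a b : p a <> 0%N ->
    ((p' a < p' b)%N%:R : R) = (p b == 0)%N%:R + (p a < p b)%N%:R.
  move=> /eqP a0; rewrite rotp a0 /=; have [->|] := eqVneq (p b) 0%N.
    by rewrite ltn0 /= addr0.
  by rewrite add0r.
have ltl a b : p b <> 0%N ->
    ((p' a < p' b)%N%:R : R) = (p a < p b)%N%:R - (p a == 0)%N%:R.
  move=> /eqP b0; rewrite rotp (negPf b0) /=; have [->|] := eqVneq (p a) 0%N.
    by rewrite lt0n b0 subrr.
  by rewrite subr0.
have lt0E a b : p a = 0%N -> ((p a < p b)%N%:R : R) = 1 - (p b == 0)%N%:R.
  by move=> ->; rewrite lt0n; case: (_ == _); rewrite ?subrr ?subr0.
have gt0E a b : p b = 0%N -> ((p a < p b)%N%:R : R) = 0 by move=> ->.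
have c1 : \sum_(k : N) 1 = d.+1%:R :> R by rewrite sumr_const card_ord.
have sumA a : p a = 0%N -> \sum_k ((p' a < p' k)%N%:R : R) = 0.
  by move=> a0; rewrite big1 // => k _; rewrite lt0.
have sumA0 a : p a = 0%N ->
    \sum_k ((p a < p k)%N%:R : R) = d.+1%:R - \sum_k (p k == 0)%N%:R.
  by move=> a0; rewrite -c1 -sumrB; apply: eq_bigr => k _; rewrite lt0E.
have sumA1 a : p a <> 0%N -> \sum_k ((p' a < p' k)%N%:R : R) =
    \sum_k (p k == 0)%N%:R + \sum_k (p a < p k)%N%:R.
  by move=> a0; rewrite -big_split; apply: eq_bigr => k _; rewrite ltr.
have sumB0 b : p b = 0%N ->
    \sum_k ((p' k < p' b)%N%:R : R) = d.+1%:R - \sum_k (p k == 0)%N%:R.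
  by move=> b0; rewrite -c1 -sumrB; apply: eq_bigr => k _; rewrite gt0.
have sumB b : p b = 0%N -> \sum_k ((p k < p b)%N%:R : R) = 0.
  by move=> b0; rewrite big1 // => k _; rewrite gt0E.
have sumB1 b : p b <> 0%N -> \sum_k ((p' k < p' b)%N%:R : R) =
    \sum_k (p k < p b)%N%:R - \sum_k (p k == 0)%N%:R.
  by move=> b0; rewrite -sumrB; apply: eq_bigr => k _; rewrite ltl.
have [/eqP l0|/eqP l0] := boolP (p last == 0%N);
  have [/eqP i0|/eqP i0] := boolP (p (emb i) == 0%N).
- by rewrite sumA // sumB0 // lt0 // sumA0 // sumB // gt0E //; ring.
- rewrite sumA // sumB1 // lt0 // sumA0 // lt0E //.
  by move/eqP: i0 => /negPf ->; rewrite /= mulr0n; ring.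
- rewrite sumA1 // sumB0 // gt0 // sumB // gt0E //.
  by move/eqP: l0 => /negPf ->; rewrite /= mulr0n; ring.
- rewrite sumA1 // sumB1 // ltl //.
  by move/eqP: l0 => /negPf ->; rewrite /= mulr0n; ring.
Qed.

Definition below p i := (\sum_k (p k < p i))%N.

Lemma below_lt p i j : (below p i < below p j)%N = (p i < p j)%N.
Proof.
have mono a b : (p a <= p b)%N -> (below p a <= below p b)%N.
  move=> ab; apply: leq_sum => k _.
  by case: (ltnP (p k) (p a)) => //= /leq_trans/(_ ab) ->.
apply/idP/idP => [|ij]; first by apply: contraTT; rewrite -!leqNgt; exact: mono.
rewrite /below (bigD1 i) //= [X in (_ < X)%N](bigD1 i) //= ltnn ij add0n add1n ltnS.
by apply: leq_sum => k _; case: (ltnP (p k) (p i)) => //= /ltn_trans/(_ ij) ->.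
Qed.

(** With the block of n at the end, the translation counts the labels in earlier
    blocks, which recovers the order of the blocks. *)
Lemma level_face_inj p p' : (3 <= d)%N ->
  (forall i, (p i <= p last)%N) -> (forall i, (p' i <= p' last)%N) ->
  level_face p = level_face p' -> forall i j, (p i < p j)%N = (p' i < p' j)%N.
Proof.
move=> d3 pl p'l /(block_vp_inj2 d3 (@same_level_sym p) (@same_level_sym p'))
  [E0 t].
have E i j : same_level p i j = same_level p' i j.
  by have [->|/E0//] := eqVneq i j; rewrite /same_level !eqxx.
have transE q i : (forall i, (q i <= q last)%N) ->
    translation q 0 i = (1 + below q (emb i))%:R.
  move=> ql; rewrite mxE ltnNge ql mulr0 subr0 big1 => [|k _].
    by rewrite addr0 natrD natr_sum.
  by rewrite ltnNge ql.
suff b : below p =1 below p' by move=> i j; rewrite -(below_lt p) -(below_lt p') !b.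
apply: embP => [i|].
  have /rowP/(_ i) := t; rewrite !transE // => /eqP.
  by rewrite eqr_nat eqn_add2l => /eqP.
apply: eq_bigr => k _; have := E k last; rewrite /same_level => e.
by rewrite !ltn_neqAle pl p'l e.
Qed.

Lemma hat_surj (x : N -> R) : (0 < d)%N ->
  \sum_i x (emb i) = d%:R * x last -> exists eta : V, hat eta =1 x.
Proof.
move=> d0 sx; have d0' : d%:R != 0 :> R by rewrite pnatr_eq0 -lt0n.
exists (\row_i (x (emb i) / d%:R)); apply: embP => [i|].
  by rewrite hat_emb mxE mulrCA mulfV ?mulr1.
rewrite hat_last; under eq_bigr do rewrite mxE.
by rewrite -mulr_suml sx mulrAC mulfV ?mul1r.
Qed.

(** A constant added on a block that does not contain n changes no difference
    inside a block, and it can be chosen to make the value at n the mean. *)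
Lemma hat_surj_blocks p (x : N -> R) i1 : p i1 <> p last ->
  exists eta : V, forall i j, p i = p j -> hat eta i - hat eta j = x i - x j.
Proof.
move=> i1l; have [i1' i1E] : exists i, i1 = emb i.
  by case: (unliftP last i1) i1l => [i ->|-> //]; exists i.
pose m : R := \sum_i (p (emb i) == p i1)%N%:R.
have m0 : m != 0.
  apply/eqP => /psumr_eq0P => /(_ (fun _ _ => ler0n _ _)) /(_ i1' isT).
  by rewrite -i1E eqxx => /eqP; rewrite oner_eq0.
pose c := - (\sum_i (x (emb i) - x last)) / m.
have d0 : (0 < d)%N by apply: leq_ltn_trans (ltn_ord i1').
have [|eta he] := @hat_surj (fun i => x i - x last + c * (p i == p i1)%:R) d0.
  have /eqP/negPf := i1l; rewrite eq_sym => ->.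
  by rewrite subrr mulr0 addr0 mulr0 big_split -mulr_sumr /= -/m divfK // subrr.
by exists eta => i j ij; rewrite !he ij; ring.
Qed.

(** The order of the finer string inside each block serves as the direction. *)
Lemma level_face_refine p p' i1 : p i1 <> p last ->
  (forall i j, (p i < p j)%N -> (p' i < p' j)%N) ->
  exists eta : V, level_face p' = vface (level_face p) eta.
Proof.
move=> i1l ref; have [eta he] := hat_surj_blocks (fun i => (p' i)%:R) i1l.
exists eta; apply/esym/vface_level_face => i j; rewrite /same_level.
case: (ltngtP (p i) (p j)) => [/ref->//|/ref/ltnW|/he h] /=.
  by rewrite leqNgt => /negPf.
by rewrite -subr_lt0 h subr_lt0 ltr_nat.
Qed.

(** The values p - 1, with the value on the first block replaced by the negative
    number that makes their mean 0, the value at n. *)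
Lemma level_face_proper p i0 i2 : p last = 1%N -> p i0 = 0%N -> p i2 = 2%N ->
  exists2 eta : V, ~ (exists c, eta = c *: @ones R d.+1) &
    level_face p = vface (cyclopermutohedron R d.+1) eta.
Proof.
move=> pl pi0 pi2.
have [i0' i0E] : exists i, i0 = emb i.
  by case: (unliftP last i0) pi0 => [i ->|->]; [exists i|rewrite pl].
have [i2' i2E] : exists i, i2 = emb i.
  by case: (unliftP last i2) pi2 => [i ->|->]; [exists i|rewrite pl].
have d0 : (0 < d)%N by apply: leq_ltn_trans (ltn_ord i0').
pose m : R := \sum_i (p (emb i) == 0)%N%:R.
have m0 : 0 < m.
  rewrite /m (bigD1 i0') //= -i0E pi0 eqxx ltr_wpDr ?ltr01 //.
  by apply: sumr_ge0 => i _; rewrite ler0n.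
pose u : R := \sum_i (p (emb i)).-1%:R.
have u0 : 0 < u.
  rewrite /u (bigD1 i2') //= -i2E pi2 ltr_wpDr ?ltr01 //.
  by apply: sumr_ge0 => i _; rewrite ler0n.
pose x i : R := (p i).-1%:R - u / m * (p i == 0)%N%:R.
have [|eta he] := @hat_surj x d0.
  by rewrite /x pl sumrB -mulr_sumr -/u -/m divfK ?gt_eqF // subrr !mulr0 subr0 mulr0.
have um : 0 < u / m by rewrite divr_gt0.
have lt i j : (hat eta i < hat eta j) = (p i < p j)%N.
  rewrite !he /x; case: (p i) (p j) => [|a] [|b] /=;
    rewrite ?mulr0 ?mulr1 ?subr0 ?ltxx //.
  - by rewrite sub0r (lt_le_trans (y := 0)) ?oppr_lt0 ?ler0n.
  - by apply/negbTE; rewrite -leNgt sub0r (le_trans (y := 0)) ?oppr_le0 ?ler0n ?ltW.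
  - by rewrite ltr_nat.
exists eta; last first.
  rewrite cyclopermutohedron_level_face; apply/esym/vface_level_face => i j.
  by rewrite lt /same_level ltnn eqxx.
move=> [c ec]; have := lt i0 i2.
rewrite i0E i2E !hat_emb ec !mxE ltxx -i0E -i2E pi0 pi2 //.
Qed.

End OrderedFaces.

(** * The dimension of a face *)
Section Directions.
Local Open Scope ring_scope.
Variables (R : realType) (d : nat).
Local Notation V := 'rV[R]_d.
Implicit Types (W : {vspace V}) (K L : vpolytope R d).

Definition parallel W K := exists P Q : polytope R d,
  [/\ K = vpoly P - vpoly Q, in_translate (pset P) W & in_translate (pset Q) W].

Lemma in_translateD W (P Q : polytope R d) :
  in_translate (pset P) W -> in_translate (pset Q) W -> in_translate (pset (P + Q)) W.
Proof.
move=> [a Pa] [b Qb]; exists (a + b) => _ [x Px [y Qy <-]].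
by rewrite opprD addrACA memvD ?Pa ?Qb.
Qed.

Lemma parallelD W K L : parallel W K -> parallel W L -> parallel W (K + L).
Proof.
move=> [P [Q [-> PW QW]]] [P' [Q' [-> P'W Q'W]]].
exists (P + P'), (Q + Q'); split; [|exact: in_translateD..].
by rewrite !vpolyD opprD addrACA.
Qed.

Lemma parallelN W K : parallel W K -> parallel W (- K).
Proof. by move=> [P [Q [-> PW QW]]]; exists Q, P; rewrite opprB. Qed.

Lemma parallel_vseg W (a b : V) : b - a \in W -> parallel W (vseg a b).
Proof.
move=> abW; exists (segment a b), 0; split; first by rewrite subr0.
  by exists a => x /mem_segment[l _ ->]; rewrite addrC addKr memvZ.
exists 0 => x; rewrite -[0 : polytope R d]/(Defs.point 0) pointE => ->.
by rewrite subrr mem0v.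
Qed.

Lemma vseg_diag (a : V) : vseg a a = vpt a.
Proof.
congr vpoly; apply: pset_inj; rewrite pointE; apply/seteqP; split=> [x|x ->].
  by move=> /mem_segment[l _ ->]; rewrite subrr scaler0 addr0.
by apply/mem_segment; exists 0; rewrite ?lexx ?ler01 // scale0r addr0.
Qed.

Lemma parallel_vpt W (a : V) : parallel W (vpt a).
Proof. by rewrite -vseg_diag; apply: parallel_vseg; rewrite subrr mem0v. Qed.

Lemma parallel_sum W (I : Type) (r : seq I) (P : pred I) (F : I -> vpolytope R d) :
  (forall i, P i -> parallel W (F i)) -> parallel W (\sum_(i <- r | P i) F i).
Proof.
by move=> PF; apply: big_ind => //; [exact: (parallel_vpt W 0)|exact: parallelD].
Qed.

Lemma vface_parallel W K (eta : V) : parallel W K ->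
  (forall w, w \in W -> dotp w eta = 0) -> vface K eta = K.
Proof.
have face (P : polytope R d) : in_translate (pset P) W ->
    (forall w, w \in W -> dotp w eta = 0) ->
    pface P eta = P.
  move=> [a Pa] We; apply: (@pface_const _ _ _ _ (dotp a eta)) => x /Pa/We.
  by rewrite dotpBl => /eqP; rewrite subr_eq0 => /eqP.
by move=> [P [Q [-> PW QW]]] We; rewrite vfaceB !face.
Qed.

(** A coordinate of the component of v in a complement of W. *)
Lemma orthogonal_separation W (v : V) : v \notin W ->
  exists eta : V, (forall w, w \in W -> dotp w eta = 0) /\ dotp v eta <> 0.
Proof.
move=> vW; pose f u := u - projv W u.
have fW w : w \in W -> f w = 0 by move=> wW; rewrite /f projv_id ?subrr.
have : f v != 0.
  by apply: contra vW; rewrite subr_eq0 => /eqP ->; exact: memv_proj.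
move=> /rV0Pn[j fvj]; exists (\row_i f (delta_mx 0 i) 0 j).
have fE u : dotp u (\row_i f (delta_mx 0 i) 0 j) = f u 0 j.
  rewrite {2}[u]row_sum_delta /f linear_sum -sumrB summxE.
  by apply: eq_bigr => i _; rewrite linearZ -scalerBr !mxE.
split=> [w /fW|]; first by rewrite fE => ->; rewrite mxE.
by rewrite fE; apply/eqP.
Qed.

End Directions.

Section Dimension.
Local Open Scope ring_scope.
Variables (R : realType) (d : nat).
Local Notation V := 'rV[R]_d.
Local Notation N := 'I_d.+1.
Local Notation last := (@ord_max d).
Variables (p : N -> nat) (k : nat).
Hypotheses (p_lt : forall i, (p i < k)%N)
  (p_surj : forall b, (b < k)%N -> exists i, p i = b)
  (k2 : (2 <= k)%N) (d3 : (3 <= d)%N).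

(** A representative of the block b, which is n whenever n is in it. *)
Definition rep (b : nat) : N :=
  if b == p last then last else odflt last [pick j | p j == b].

Lemma p_rep i : p (rep (p i)) = p i.
Proof.
rewrite /rep; case: eqVneq => [->//|_].
by case: pickP => [j /eqP//|/(_ i)]; rewrite eqxx.
Qed.

Definition nonrep := [set i | rep (p i) != i].

Lemma card_nonrep : #|nonrep| = (d.+1 - k)%N.
Proof.
rewrite -[in RHS](card_ord d.+1) -(cardsC nonrep).
suff -> : #|~: nonrep| = k by rewrite addnK.
rewrite -[RHS](card_ord k) -cardsT.
have -> : [set: 'I_k] = [set Ordinal (p_lt i) | i in ~: nonrep].
  apply/esym/setP => b; rewrite inE; apply/imsetP.
  have [i ib] := p_surj (ltn_ord b); exists (rep b); last first.
    by apply/val_inj; rewrite /= -ib p_rep.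
  by rewrite !inE negbK -ib p_rep.
rewrite card_in_imset // => i j; rewrite !inE !negbK => /eqP ri /eqP rj [] ij.
by rewrite -ri -rj ij.
Qed.

Lemma levels_nonconstant : exists i1, p i1 <> p last.
Proof.
have [i i0] := p_surj (ltnW k2); have [j j1] := p_surj k2.
have [il|/eqP] := eqVneq (p i) (p last); last by exists i.
by exists j; rewrite -il i0 j1.
Qed.

Definition block_dir i : V := ehat R i - ehat R (rep (p i)).

Lemma dotp_block_dir i eta : dotp (block_dir i) eta = hat eta i - hat eta (rep (p i)).
Proof. exact: dotpBl. Qed.

Definition block_dirs := [tuple block_dir (enum_val i) | i < #|nonrep|].

(** For a label that is not a representative, [hat_surj_blocks] gives a direction
    on which only the vector of this label is nonzero. *)
Lemma free_block_dirs : free block_dirs.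
Proof.
apply/freeP => c c0 i; have [i1 i1l] := levels_nonconstant.
have [eta he] := hat_surj_blocks (fun j => (j == enum_val i)%:R : R) i1l.
have dE j : dotp block_dirs`_(j : 'I__) eta = (j == i)%:R.
  rewrite nth_mktuple dotp_block_dir he ?p_rep // (inj_eq enum_val_inj).
  case: eqP => [->|_].
    have := enum_valP i; rewrite inE => /negPf ->; exact: subr0.
  rewrite -[LHS]/(0 - _).
  (* enum_val i represents no block, so it is not the representative of j *)
  case: eqP => [e|_]; last exact: subr0.
  have := enum_valP i; rewrite inE -e p_rep eqxx //.
have := dotp_suml (fun j => c j) (fun j : 'I__ => block_dirs`_j) eta.
rewrite c0 dotp0 (bigD1 i) //= dE eqxx mulr1 big1 ?addr0 // => j /negPf ji.
by rewrite dE ji mulr0.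
Qed.

Lemma dim_block_dirs : \dim <<block_dirs>> = (d.+1 - k)%N.
Proof.
by have := free_block_dirs; rewrite /free => /eqP ->; rewrite size_tuple card_nonrep.
Qed.

Lemma block_dir_span i : block_dir i \in <<block_dirs>>%VS.
Proof.
have [i_nr|] := boolP (i \in nonrep).
  apply: memv_span; apply/tnthP; exists (enum_rank_in i_nr i).
  by rewrite tnth_mktuple enum_rankK_in.
by rewrite inE negbK /block_dir => /eqP ->; rewrite subrr mem0v.
Qed.

Lemma same_level_span i j : same_level p i j ->
  ehat R i - ehat R j \in <<block_dirs>>%VS.
Proof.
move=> /eqP ij; have -> : ehat R i - ehat R j = block_dir i - block_dir j.
  by rewrite /block_dir ij opprB addrA subrK.
by rewrite memvB ?block_dir_span.
Qed.

Lemma parallel_level_face : parallel <<block_dirs>> (level_face R p).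
Proof.
have d0 : d%:R != 0 :> R by rewrite pnatr_eq0 -lt0n; apply: leq_trans d3.
apply: parallelD; first apply: parallelD; [|exact: parallel_vpt|apply: parallelN].
  apply: parallel_sum => i _; apply: parallel_sum => j /andP[_ ij].
  apply: parallel_vseg.
  rewrite -[_ - _]scale1r -(mulVf d0) -scalerA memvZ // scalerBr -!ehat_emb.
  by rewrite same_level_span // same_level_sym.
apply: parallel_sum => i il; apply: parallel_vseg; rewrite subr0.
exact: same_level_span.
Qed.

(** A direction orthogonal to W does not change the face, so by injectivity it is
    constant on each block; hence it is orthogonal to the vectors [block_dir], and
    these lie in W. *)
Lemma parallel_level_face_span W :
  parallel W (level_face R p) -> (<<block_dirs>> <= W)%VS.
Proof.
move=> pW; apply/span_subvP => _ /tnthP[i ->]; rewrite tnth_mktuple.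
move: (enum_val i) => {}i; apply/negPn/negP => /orthogonal_separation[eta [We]].
rewrite dotp_block_dir; apply; apply/eqP; rewrite subr_eq0.
have := vface_parallel pW We.
rewrite /level_face vface_block_vp; last exact: same_level_sym.
move=> /(block_vp_inj2 d3)[||+ _]; last first.
- have [<-|ri] := eqVneq i (rep (p i)) => [_|/(_ _ _ ri)]; first exact: eqxx.
  by rewrite /same_level p_rep eqxx.
- exact: same_level_sym.
- by move=> a b; rewrite same_level_sym eq_sym.
Qed.

Lemma vdim_level_face : vdim (level_face R p) = (d.+1 - k)%N.
Proof.
rewrite -dim_block_dirs /vdim; case: ex_minnP.
move=> m /asboolP[P [Q [W [PQ PW QW <-]]]] min.
apply/eqP; rewrite eqn_leq; apply/andP; split.
  apply: min; apply/asboolP; have [P' [Q' [PQ' P'W Q'W]]] := parallel_level_face.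
  by exists P', Q', <<block_dirs>>%VS.
by apply/dimvS/parallel_level_face_span; exists P, Q.
Qed.

End Dimension.

(** * Strings of blocks *)
Section OrderedPartitions.
Variable T : finType.
Implicit Types (A B : {set T}) (s t : seq {set T}) (ss : seq (seq {set T})).

(** Counting the blocks through each label is additive under concatenation and
    invariant under permutation, unlike the definition through sets of blocks. *)
Lemma ordered_partitionP A s : reflect
  (finset.set0 \notin s /\ forall i, count (fun B => i \in B) s = (i \in A))
  (ordered_partition A s).
Proof.
apply: (iffP idP).
  move=> /andP[us /and3P[/eqP cov triv s0]]; split; first by rewrite inE in s0.
  move=> i; have [iA|iA] := boolP (i \in A).
    move: iA; rewrite -cov => /bigcupP[B]; rewrite inE => Bs iB.
    rewrite (@eq_in_count _ _ (pred1 B)) ?count_uniq_mem ?Bs // => C Cs /=.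
    apply/idP/eqP => [iC|->//]; apply/eqP/negPn/negP => CB.
    have := finset.trivIsetP triv C B; rewrite !inE => /(_ Cs Bs CB).
    by rewrite disjoint_subset => /fintype.subsetP/(_ i iC); rewrite inE iB.
  apply/eqP; rewrite -leqn0 leqNgt -has_count; apply: contra iA => /hasP[B Bs iB].
  by rewrite -cov; apply/bigcupP; exists B; rewrite ?inE.
move=> [s0 cnt]; have c1 i : (count (fun B => i \in B) s <= 1)%N.
  by rewrite cnt leq_b1.
apply/andP; split.
  apply: count_mem_uniq => B; case: (boolP (B \in s)) => Bs; last exact/count_memPn.
  have /set0Pn[i iB] : B != finset.set0 by apply: contraNneq s0 => <-.
  apply/eqP; rewrite eqn_leq -has_count has_pred1 Bs andbT.
  by apply: leq_trans (c1 i); apply: sub_count => C /eqP ->.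
apply/and3P; split; last by rewrite inE.
  apply/eqP/setP => i; rewrite -[RHS]lt0b -cnt -has_count.
  apply/bigcupP/hasP => [[B]|[B Bs iB]]; first by rewrite inE => Bs iB; exists B.
  by exists B; rewrite ?inE.
apply/finset.trivIsetP => B C; rewrite !inE => Bs Cs BC; rewrite disjoint_subset.
apply/fintype.subsetP => i iB; rewrite inE; apply/negP => iC.
suff: (2 <= count (fun B => i \in B) s)%N by rewrite ltnNge c1.
apply: (@leq_trans (count (predU (pred1 B) (pred1 C)) s)); last first.
  by apply: sub_count => D /orP[]/eqP ->.
have no_both : predI (pred1 B) (pred1 C) =1 pred0.
  by move=> D /=; apply/negbTE/negP => /andP[/eqP-> ]; exact/negP.
have := count_predUI (pred1 B) (pred1 C) s;
rewrite (eq_count no_both) count_pred0 addn0.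
by move=> ->; apply: (@leq_add 1 1); rewrite -has_count has_pred1.
Qed.

Definition rank s i := find (fun B : {set T} => i \in B) s.

Lemma has_block A s i : ordered_partition A s -> has (fun B => i \in B) s = (i \in A).
Proof. by move=> /ordered_partitionP[_ cnt]; rewrite has_count cnt lt0b. Qed.

Lemma rank_lt A s i : ordered_partition A s -> i \in A -> (rank s i < size s)%N.
Proof. by move=> os; rewrite -(has_block i os) has_find. Qed.

Lemma mem_rank A s i : ordered_partition A s -> i \in A ->
  i \in nth finset.set0 s (rank s i).
Proof. by move=> os; rewrite -(has_block i os) => /(nth_find finset.set0). Qed.

Lemma rank_nth A s b i : ordered_partition A s -> (b < size s)%N ->
  i \in nth finset.set0 s b -> rank s i = b.
Proof.
move=> /ordered_partitionP[_ cnt] bs ib; have := leq_b1 (i \in A); rewrite -cnt.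
rewrite -{1}(cat_take_drop b s) (drop_nth finset.set0 bs) count_cat /= ib addnCA.
rewrite -[X in (_ <= X)%N]addn0 leq_add2l leqn0 addn_eq0 => /andP[/eqP h _].
rewrite /rank -(cat_take_drop b s) (drop_nth finset.set0 bs) find_cat has_count h /=.
by rewrite ib addn0 size_take bs.
Qed.

Lemma block_nonempty A s b : ordered_partition A s -> (b < size s)%N ->
  exists2 i, i \in A & rank s i = b.
Proof.
move=> os bs; have /ordered_partitionP[s0 _] := os.
have /set0Pn[i ib] : nth finset.set0 s b != finset.set0.
  by apply: contraNneq s0 => <-; exact: mem_nth.
exists i; last exact: (rank_nth os bs ib).
rewrite -(has_block i os); apply/hasP; exists (nth finset.set0 s b) => //.
exact: mem_nth.
Qed.

Lemma block_subset A s B : ordered_partition A s -> B \in s -> B \subset A.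
Proof.
move=> os Bs; apply/fintype.subsetP => i iB; rewrite -(has_block i os).
by apply/hasP; exists B.
Qed.

Lemma ordered_partition_rot A s k :
  ordered_partition A (rot k s) = ordered_partition A s.
Proof.
have e : perm_eq (rot k s) s by rewrite perm_rot.
apply/ordered_partitionP/ordered_partitionP => -[s0 cnt]; split.
- by rewrite -(mem_rot k).
- by move=> i; rewrite -cnt; apply/esym/permP.
- by rewrite mem_rot.
- by move=> i; rewrite -cnt; apply/permP.
Qed.

(** The ranks fill an initial segment of the integers, so they are determined by
    the order that they induce. *)
Lemma rank_mono_inj s t :
  ordered_partition [set: T] s -> ordered_partition [set: T] t ->
  (forall i j, (rank s i < rank s j)%N = (rank t i < rank t j)%N) ->
  s = t.
Proof.
have le u v : ordered_partition [set: T] u ->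
    (forall i j, (rank u i < rank u j)%N = (rank v i < rank v j)%N) ->
    forall i, (rank u i <= rank v i)%N.
  move=> ou lt i; move: {2}(rank u i) (erefl (rank u i)) => b.
  elim: b i => [|b IH] i ib; first by rewrite ib.
  have [|j _ jb] := @block_nonempty _ u b ou.
    by apply: ltnW; rewrite -ib (rank_lt ou) ?inE.
  have : (rank u j < rank u i)%N by rewrite jb ib.
  by rewrite lt ib; apply: leq_ltn_trans; rewrite -jb IH.
move=> os ot lt; have pE i : rank s i = rank t i.
  by apply/eqP; rewrite eqn_leq !le.
have sz u v : ordered_partition [set: T] u -> ordered_partition [set: T] v ->
    (forall i, rank u i = rank v i) -> (size u <= size v)%N.
  move=> ou ov e; rewrite leqNgt; apply/negP => vu.
  by have [i _ iv] := block_nonempty ou vu;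
  have := rank_lt ov (finset.in_setT i); rewrite -e iv ltnn.
have st : size s = size t by apply/eqP; rewrite eqn_leq !sz.
apply: (@eq_from_nth _ finset.set0) => // b bs; apply/setP => i.
apply/idP/idP => ib.
  by rewrite -(rank_nth os bs ib) pE (mem_rank ot) ?inE.
by rewrite st in bs; rewrite -(rank_nth ot bs ib) -pE (mem_rank os) ?inE.
Qed.

Lemma rank_rot1 s i j : ordered_partition [set: T] s ->
  (rank (rot 1 s) i < rank (rot 1 s) j)%N =
  (rank s i != 0)%N && ((rank s j == 0)%N || (rank s i < rank s j)%N).
Proof.
case: s => [|B s] os; first by rewrite /rank /rot.
rewrite rot1_cons /rank -cats1 !find_cat.
have hasE (k : T) : has (fun C : {set T} => k \in C) s = (k \notin B).
  have /ordered_partitionP[_ /(_ k)] := os; rewrite /= inE has_count.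
  case: (k \in B); first by rewrite add1n => -[->].
  by rewrite add0n => ->.
rewrite !hasE; have sz (k : T) :
    k \notin B -> (find (fun C : {set T} => k \in C) s < size s)%N.
  by rewrite -has_find hasE.
case iB: (i \in B); case jB: (j \in B); rewrite /= ?iB ?jB ?addn0 ?ltnn //=.
- by apply/negbTE; rewrite -leqNgt ltnW // sz ?jB.
- by rewrite sz ?iB.
Qed.

Lemma rank_flatten s ss : all2 (@ordered_partition T) s ss -> forall i j,
  (rank (flatten ss) i < rank (flatten ss) j)%N =
  (rank s i < rank s j)%N || (rank s i == rank s j) &&
    (rank (nth [::] ss (rank s i)) i < rank (nth [::] ss (rank s i)) j)%N.
Proof.
elim: s ss => [|B s IH] [|u ss] //= /andP[ou oss] i j.
rewrite /rank /= !find_cat !(has_block _ ou).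
case: (boolP (i \in B)) => iB; case: (boolP (j \in B)) => jB //=.
- by rewrite ltn_addr // (rank_lt ou).
- by apply/negbTE; rewrite -leqNgt (leq_trans (ltnW (rank_lt ou jB))) ?leq_addr.
- by rewrite ltn_add2l IH.
Qed.

Lemma ordered_partition_flatten A s ss : ordered_partition A s ->
  all2 (@ordered_partition T) s ss -> ordered_partition A (flatten ss).
Proof.
move=> /ordered_partitionP[_ cnt] oss; apply/ordered_partitionP; split.
  elim: s ss oss {cnt} => [|B s IH] [|u ss] //= /andP[/ordered_partitionP[u0 _] oss].
  by rewrite mem_cat negb_or u0 IH.
move=> i; rewrite -cnt; elim: s ss oss {cnt} => [|B s IH] [|u ss] //=.
by move=> /andP[/ordered_partitionP[_ cnt] oss]; rewrite count_cat cnt IH.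
Qed.

Lemma flatten_sub s ss C : all2 (@ordered_partition T) s ss -> C \in flatten ss ->
  exists2 B, B \in s & C \subset B.
Proof.
elim: s ss => [|B s IH] [|u ss] //= /andP[ou oss]; rewrite mem_cat => /orP[Cu|].
  by exists B; rewrite ?mem_head // (block_subset ou).
by move=> /(IH _ oss)[D Ds CD]; exists D; rewrite // inE Ds orbT.
Qed.

End OrderedPartitions.

Section LevelSets.
Variables (T : finType) (disp : Order.disp_t) (X : orderType disp) (x : T -> X).
Implicit Type B : {set T}.

Definition values B := sort <=%O (undup [seq x i | i <- enum B]).

Definition level_sets B := [seq [set i in B | x i == v] | v <- values B].

Lemma mem_values B i : i \in B -> x i \in values B.
Proof. by move=> iB; rewrite mem_sort mem_undup map_f // mem_enum. Qed.

Lemma rank_level_sets B i : i \in B ->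
  rank (level_sets B) i = index (x i) (values B).
Proof.
by move=> iB; rewrite /rank find_map; apply: eq_find => v; rewrite /= inE iB eq_sym.
Qed.

Lemma level_sets_partition B : ordered_partition B (level_sets B).
Proof.
apply/ordered_partitionP; split.
  apply/mapP => -[v]; rewrite mem_sort mem_undup => /mapP[i].
  rewrite mem_enum => iB ->.
  by move=> /setP/(_ i); rewrite !inE iB eqxx.
move=> i; rewrite count_map; have [iB|iB] := boolP (i \in B).
  rewrite (@eq_count _ _ (pred1 (x i))) => [|v]; last by rewrite /= inE iB eq_sym.
  by rewrite count_uniq_mem ?mem_values // sort_uniq undup_uniq.
by rewrite (@eq_count _ _ pred0) ?count_pred0 // => v; rewrite /= inE (negPf iB).
Qed.

Lemma rank_level_sets_lt B i j : i \in B -> j \in B ->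
  (rank (level_sets B) i < rank (level_sets B) j)%N = (x i < x j)%O.
Proof.
move=> iB jB; rewrite !rank_level_sets //.
have srt : sorted <%O (values B) by rewrite sort_lt_sorted undup_uniq.
have lt a b : a \in B -> b \in B ->
    (index (x a) (values B) < index (x b) (values B))%N -> (x a < x b)%O.
  by move=> aB bB; apply: (sorted_ltn_index lt_trans srt); exact: mem_values.
apply/idP/idP; first exact: lt.
apply: contraTT; rewrite -leqNgt -leNgt leq_eqVlt => /orP[/eqP e|].
  by rewrite (index_inj (x i) (mem_values jB) (mem_values iB) e).
by move=> /lt -/(_ jB iB)/ltW.
Qed.

End LevelSets.

(** * The face attached to a cyclically ordered partition *)
Section CyclicPartitionFaces.
Local Open Scope ring_scope.
Local Open Scope quotient_scope.
Variables (R : realType) (d : nat).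
Local Notation V := 'rV[R]_d.
Local Notation last := (@ord_max d).
Local Notation part := (cyclic_partition d.+1).
Local Notation string := (ostring d.+1).
Implicit Types (s t : string) (c : part).

Lemma stringP s : ordered_partition [set: 'I_d.+1] s.
Proof. by case: s. Qed.

Lemma rot_string_subproof s k : ordered_partition [set: 'I_d.+1] (rot k s).
Proof. by rewrite ordered_partition_rot stringP. Qed.

Definition rot_string s k : string := OString (rot_string_subproof s k).

Lemma pi_rot_string s k : \pi_(part) (rot_string s k) = \pi_(part) s.
Proof. by apply/eqmodP/rotatedW/asboolP; exists k. Qed.

Lemma level_face_rot_string s k :
  level_face R (rank (rot k s)) = level_face R (rank s).
Proof.
elim: k => [|k IH]; first by rewrite rot0.
have [sk|sk] := leqP (size s) k; first by rewrite rot_oversize // leqW.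
rewrite rotS // -{}IH; apply: level_face_rot => i j.
exact: rank_rot1 (rot_string_subproof s k).
Qed.

Definition cyclic_face c : vpolytope R d := level_face R (rank (repr c)).

Lemma cyclic_face_pi s : cyclic_face (\pi_(part) s) = level_face R (rank s).
Proof.
have /eqmodP/asboolP[k ->] : \pi_(part) (repr (\pi_(part) s)) = \pi_(part) s.
  by rewrite reprK.
by rewrite level_face_rot_string.
Qed.

Lemma nparts_pi s : nparts (\pi_(part) s) = size s.
Proof.
rewrite /nparts cparts_pi cardsE; apply/card_uniqP.
by have /andP[] := stringP s.
Qed.

Lemma string_last c :
  exists s, c = \pi_(part) s /\ (forall i, (rank s i <= rank s last)%N).
Proof.
elim/quotW: c => s; set b := rank s last.
have bs : (b < size s)%N by apply: (rank_lt (stringP s)); rewrite inE.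
exists (rot_string s b.+1); rewrite pi_rot_string; split=> // i.
have E : rot b.+1 s = rcons (drop b.+1 s ++ take b s) (nth finset.set0 s b).
  by rewrite /rot (take_nth finset.set0 bs) rcons_cat.
have -> : rank (rot_string s b.+1) last = (size s).-1.
  apply: (rank_nth (stringP _)); rewrite /= ?size_rot ?prednK //.
  - exact: leq_ltn_trans bs.
  have -> : (size s).-1 = size (drop b.+1 s ++ take b s).
    by rewrite -(size_rot b.+1 s) E size_rcons.
  by rewrite E nth_rcons ltnn eqxx (mem_rank (stringP s)) ?inE.
rewrite -ltnS prednK; last exact: leq_ltn_trans bs.
rewrite -(size_rot b.+1 s).
by apply: (rank_lt (stringP (rot_string s b.+1))); rewrite inE.
Qed.

(** With n in the second of at least three blocks, there is a block on each side
    of it, as for the mean of a nonconstant function. *)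
Lemma string_second c : (3 <= nparts c)%N ->
  exists s, c = \pi_(part) s /\ rank s last = 1%N.
Proof.
have [s [-> sl]] := string_last c; rewrite nparts_pi => s3.
have os := stringP s.
have lE : rank s last = (size s).-1.
  have s0 : (0 < size s)%N by apply: leq_trans s3.
  have [|i _ ib] := @block_nonempty _ _ s (size s).-1 os; first by rewrite prednK.
  apply/eqP; rewrite eqn_leq; apply/andP; split; last by rewrite -ib.
  by rewrite -ltnS prednK // (rank_lt os) ?inE.
exists (rot_string s (size s - 2)); rewrite pi_rot_string; split=> //.
apply: (rank_nth (stringP _)); rewrite /= ?size_rot ?(leq_trans _ s3) //.
rewrite /rot nth_cat size_drop subKn ?(leq_trans _ s3) //= nth_drop.
have -> : (size s - 2 + 1)%N = rank s last by rewrite lE; lia.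
by rewrite (mem_rank os) ?inE.
Qed.

Lemma cyclic_face_inj : (3 <= d)%N -> injective cyclic_face.
Proof.
move=> d3 c c'; have [s [-> sl]] := string_last c.
have [t [-> tl]] := string_last c'.
rewrite !cyclic_face_pi => /(level_face_inj d3 sl tl) st.
congr (\pi_(part) _); apply/val_inj.
exact: (rank_mono_inj (stringP s) (stringP t) st).
Qed.

Lemma cyclic_face_proper c : (3 <= nparts c)%N ->
  proper_face (n := d.+1) (cyclic_face c).
Proof.
move=> c3; have [s [cs sl]] := string_second c3.
rewrite {}cs nparts_pi cyclic_face_pi in c3 *; have os := stringP s.
have [|i0 _ i0E] := @block_nonempty _ _ s 0 os; first exact: leq_trans c3.
have [|i2 _ i2E] := @block_nonempty _ _ s 2 os; first exact: leq_trans c3.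
by have [eta etaN ->] := level_face_proper R sl i0E i2E; exists eta.
Qed.

Lemma vdim_cyclic_face c : (3 <= d)%N -> (2 <= nparts c)%N ->
  vdim (cyclic_face c) = (d.+1 - nparts c)%N.
Proof.
move=> d3; elim/quotW: c => s; rewrite nparts_pi cyclic_face_pi => s2.
apply: vdim_level_face => // [i|b bs].
  by apply: (rank_lt (stringP s)); rewrite inE.
by have [i _ ib] := block_nonempty (stringP s) bs; exists i.
Qed.

Lemma refines_is_face c' c : (2 <= nparts c)%N -> refines c' c ->
  is_face (cyclic_face c') (cyclic_face c).
Proof.
move=> c2 [s [t [ss [cs -> sss tE]]]].
move: c2; rewrite cs nparts_pi !cyclic_face_pi => s2.
have surj b : (b < size s)%N -> exists i, rank s i = b.
  by move=> /(block_nonempty (stringP s))[i _ ib]; exists i.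
have [i1 i1l] := levels_nonconstant surj s2.
apply: (level_face_refine R i1l) => i j ij; rewrite tE.
by rewrite (rank_flatten sss) ij.
Qed.

(** Each block is cut into the level sets of the direction. *)
Lemma face_is_cyclic_face c F : is_face F (cyclic_face c) ->
  exists2 c', refines c' c & cyclic_face c' = F.
Proof.
move=> [eta ->]; elim/quotW: c => s; rewrite cyclic_face_pi.
pose ss := [seq level_sets (hat eta) B | B <- s].
have sss : all2 (@ordered_partition 'I_d.+1) s ss.
  rewrite /ss; elim: (parts_seq s) => //= B u ->.
  by rewrite level_sets_partition.
pose t := OString (ordered_partition_flatten (stringP s) sss).
exists (\pi_(part) t); first by exists s, t, ss.
rewrite cyclic_face_pi; apply/esym/vface_level_face => i j.
rewrite (rank_flatten sss) /same_level; congr (_ || _).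
have [ij|//] := eqVneq (rank s i) (rank s j).
rewrite /ss (nth_map finset.set0) /=.
  rewrite rank_level_sets_lt //; first by rewrite (mem_rank (stringP s)) ?inE.
  by rewrite ij (mem_rank (stringP s)) ?inE.
by apply: (rank_lt (stringP s)); rewrite inE.
Qed.

End CyclicPartitionFaces.

(** * Admissible partitions *)
Section Admissibility.
Local Open Scope ring_scope.
Local Open Scope quotient_scope.
Variables (R : realType) (d : nat) (l : 'I_d.+1 -> R).
Hypothesis l_gt0 : linkage l.

Lemma refines_admissible c' c : refines c' c -> admissible l c -> admissible l c'.
Proof.
move=> [s [t [ss [-> -> sss tE]]]]; rewrite /admissible !cparts_pi.
move=> /forall_inP adm; apply/forall_inP => I; rewrite inE tE.
move=> /(flatten_sub sss)[B Bs IB]; have := adm B; rewrite inE => /(_ Bs) leB.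
have sub (X Y : {set 'I_d.+1}) : X \subset Y ->
    \sum_(i in X) l i <= \sum_(i in Y) l i.
  move=> /fintype.subsetP XY; rewrite [leLHS]big_mkcond [leRHS]big_mkcond.
  apply: ler_sum => i _; case: (boolP (i \in X)) => [/XY ->//|_].
  by case: ifP => // _; exact: ltW.
apply: le_trans (sub _ _ IB) _; apply: le_trans leB _.
by apply: sub; rewrite finset.setCS.
Qed.

(** The vertices are the partial sums of the signed lengths on a fixed line. *)
Lemma signs_line (e : 'I_d.+1 -> R) : (forall i, e i = 1 \/ e i = -1) ->
  \sum_i e i * l i = 0 -> exists2 p, configuration l p & fits_line p.
Proof.
move=> e1 sum0; pose x (i : nat) := \sum_(j < d.+1 | (j < i)%N) e j * l j.
pose v : 'rV[R]_2 := delta_mx 0 0.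
exists (fun i : 'I_d.+1 => x i *: v); last first.
  exists 0, v; split; last by move=> i; exists (x i); rewrite add0r.
  by apply/eqP => /rowP/(_ 0) /eqP; rewrite !mxE !eqxx oner_eq0.
move=> i; rewrite /edist -scalerBl.
have -> : x i - x (ordS i) = - (e i * l i).
  have step : x i.+1 = x i + e i * l i.
    rewrite /x (bigD1 i) //= addrC; congr (_ + _); apply: eq_bigl => j.
    by rewrite ltnS ltn_neqAle andbC.
  have xS : x (ordS i) = x i.+1.
    rewrite /=; have [ilt|] := ltnP i.+1 d.+1; first by rewrite modn_small.
    move=> di; have -> : i.+1 = d.+1 by apply/eqP; rewrite eqn_leq ltn_ord.
    rewrite modnn /x big_pred0 // -[LHS]sum0; apply: eq_bigl => j.
    by rewrite ltn_ord.
  by rewrite xS step opprD addrA subrr add0r.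
rewrite /dotp (bigD1 0) //= big1 ?addr0 => [|j j0].
  rewrite !mxE !eqxx mulr1 -expr2 sqrrN sqrtr_sqr normrM (gtr0_norm (l_gt0 i)).
  by case: (e1 i) => ->; rewrite ?normrN normr1 mul1r.
by rewrite !mxE (negPf j0) /= !mulr0.
Qed.

Hypothesis l_generic : forall p, configuration l p -> ~ fits_line p.

Lemma admissible_nparts c : admissible l c -> (3 <= nparts c)%N.
Proof.
elim/quotW: c => s; rewrite /admissible nparts_pi cparts_pi => /forall_inP adm.
have {}adm B : B \in parts_seq s -> \sum_(i in B) l i <= \sum_(i in ~: B) l i.
  by move=> Bs; apply: adm; rewrite inE.
have os := stringP s; have /ordered_partitionP[_ cnt] := os.
case: (parts_seq s) adm cnt => [|A [|B [|]]] //= adm cnt.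
- by have := cnt ord0; rewrite inE.
- have A1 : A = finset.setT.
    by apply/setP => i; have := cnt i; rewrite !inE addn0; case: (i \in A).
  have := adm A (mem_head _ _); rewrite A1 finset.setCT big_set0 leNgt => /negP[].
  rewrite (bigD1 ord0) ?inE //= ltr_wpDr //; apply: sumr_ge0 => i _; exact: ltW.
have BE : B = ~: A.
  apply/setP => i; have := cnt i; rewrite !inE addn0.
  by case: (i \in A); case: (i \in B).
have AB : \sum_(i in A) l i = \sum_(i in ~: A) l i.
  apply/eqP; rewrite eq_le adm ?mem_head //=.
  by have := adm B; rewrite BE finset.setCK => -> //; rewrite -BE !inE eqxx orbT.
pose e i : R := if i \in A then 1 else -1.
have [||p cp /(l_generic cp)//] := @signs_line e.
  by move=> i; rewrite /e; case: ifP => _; [left|right].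
rewrite (bigID (fun i => i \in A)) /=.
rewrite (eq_bigr l) => [|i iA]; last by rewrite /e iA mul1r.
rewrite AB [X in _ + X](eq_bigr (fun i => - l i)) => [|i /negPf iA]; last first.
  by rewrite /e iA mulN1r.
rewrite sumrN [X in X - _](eq_bigl (fun i => i \notin A)) ?subrr // => i.
by rewrite inE.
Qed.

End Admissibility.

Theorem theorem2 (R : realType) (n : nat) (l : 'I_n -> R)
    (n_ge4 : (4 <= n)%N)
    (l_linkage : linkage l)
    (l_triangle : triangle_inequality l)
    (l_generic : forall p : 'I_n -> 'rV[R]_2, configuration l p -> ~ fits_line p) :
  exists f : cell l -> vpolytope R n.-1,
    (forall C : cell l, proper_face (f C)) /\
    injective f /\
    (forall C : cell l, vdim (f C) = cell_dim C) /\
    (forall C C' : cell l, cell_incident C C' <-> is_face (f C) (f C')) /\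
    (forall (C : cell l) (F : vpolytope R n.-1),
        is_face F (f C) -> exists C' : cell l, f C' = F).
Proof.
case: n => [//|d] in l n_ge4 l_linkage l_triangle l_generic *.
have C3 (C : cell l) : (3 <= nparts (val C))%N.
  exact: (admissible_nparts l_linkage l_generic (valP C)).
have inj := @cyclic_face_inj R d n_ge4.
exists (fun C => cyclic_face R (val C)); split; [|split; [|split; [|split]]].
- by move=> C; apply: cyclic_face_proper.
- by move=> C C' /inj/val_inj.
- by move=> C; apply: vdim_cyclic_face => //; exact: ltnW.
- move=> C C'; split; first by apply: refines_is_face; exact: ltnW.
  by move=> /face_is_cyclic_face[c ref /inj cE]; rewrite /cell_incident -cE.
- move=> C F /face_is_cyclic_face[c ref cF].
  by exists (exist _ c (refines_admissible l_linkage ref (valP C))).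
Qed.
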